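(* Let $d\ge2$. Let $T$ be a random variable with $2d+1\le T<\infty$ a.s., $\mathbb{E}[T^{1/(4d)}]=\infty$ and $\mathbb{E}[T^{1/(8d)}]<\infty$, and let $i_0$ be a random variable independent of $T$ and uniform on $\{1,\dots,2d\}$. Let $\epsilon\in\bigl(\frac1{2d+1},\frac{2d}{2d+1}\bigr)$. Let $\mathbf{P}^{\mathrm{expl}}$ be the law of the i.i.d. environment on $\mathbb{Z}^d$ in which $p^\omega(0,\cdot)$ is given by $$p^\omega(0,e_i)=\begin{cases}\dfrac1T & \text{if } i=i_0,\\[2mm] \dfrac{1-\epsilon-\frac{\mathbf{1}\{1\le i_0\le d\}}{T}}{d-\mathbf{1}\{1\le i_0\le d\}} & \text{if } i\in\{1,\dots,d\}\setminus\{i_0\},\\[4mm] \dfrac{\epsilon-\frac{\mathbf{1}\{d+1\le i_0\le 2d\}}{T}}{d-\mathbf{1}\{d+1\le i_0\le2d\}} & \text{if } i\in\{d+1,\dots,2d\}\setminus\{i_0\}.\end{cases}$$ Then the environment $\mathbf{P}^{\mathrm{expl}}$ verifies condition $(K)_1$ but does not verify condition $(E')_1$. Furthermore, a random walk in random environment with environment law $\mathbf{P}^{\mathrm{expl}}$ verifies condition $(T)$ and condition $(E)_0$.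
   Context: Setting. $U$ is the set of the $2d$ canonical unit vectors of $\mathbb{Z}^d$, enumerated as $e_1,\dots,e_{2d}$, where $e_1,\dots,e_d$ is an orthonormal basis of $\mathbb{Z}^d$ and $e_{i+d}=-e_i$ for $1\le i\le d$. $\mathcal{P}=\{(p(e))_{e\in U}: p(e)\ge 0,\ \sum_{e\in U}p(e)=1\}$. An environment is $\omega\in\Omega=\mathcal{P}^{\mathbb{Z}^d}$, i.e. a family $p^\omega(x,\cdot)=(p^\omega(x,e))_{e\in U}$, $x\in\mathbb{Z}^d$. The quenched law $P^\omega_x$ is the law of the Markov chain $(X_n)_{n\ge0}$ on $\mathbb{Z}^d$ with $P_x^\omega[X_0=x]=1$ and $P_x^\omega[X_{n+1}=y+e\mid X_n=y]=p^\omega(y,e)$. The environment has law $\mathbf{P}$ (expectation $\mathbf{E}$), under which the $p^\omega(x,\cdot)$, $x\in\mathbb{Z}^d$, are i.i.d.; here $\mathbf{P}=\mathbf{P}^{\mathrm{expl}}$. The annealed law is $\mathbb{P}=\int P^\omega_0\,d\mathbf{P}$. Notation. $x\sim y$ iff $\|x-y\|_1=1$; $\partial V=\{x\notin V:\exists y\in V,\ x\sim y\}$; $\partial_xA=\{y\in\partial A: x\sim y\}$ for $x\in A$; $T_A^{\mathrm{ex}}=\inf\{n\ge0:X_n\notin A\}$; $T_A=\inf\{n\ge0:X_n\in A\}$; $T_x^+=\inf\{n\ge1:X_n=x\}$. Condition $(T)$. For $\ell\in S^{d-1}$ and $b>0$, let $U_b^{\ell}(L)=\{x\in\mathbb{Z}^d:-bL\le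 x\cdot\ell\le L\}$. Given $\ell\in S^{d-1}$ and $b>0$, the walk verifies $(T)^\ell$ if there exists a neighborhood $V\subset S^{d-1}$ of $\ell$ such that for all $\ell'\in V$, $\limsup_{L\to\infty}\frac1L\ln\mathbb{P}\bigl[X_{T^{\mathrm{ex}}_{U_b^{\ell'}(L)}}\cdot\ell'<0\bigr]<0$. Condition $(T)$, written without a direction, means that $(T)^\ell$ holds for some $\ell\in S^{d-1}$. Condition $(E)_0$: for all $e\in U$ there exists $\eta_e>0$ such that $\mathbf{E}[p^\omega(0,e)^{-\eta_e}]<\infty$. Condition $(E')_1$: there exists $\{\phi(e):e\in U\}\in(0,\infty)^{2d}$ such that (1) $2\sum_{e\in U}\phi(e)-\sup_{e\in U}(\phi(e)+\phi(-e))>1$; and (2) for every $e\in U$, $\mathbf{E}\bigl[\exp\bigl(\sum_{e'\ne e}\phi(e')\log\frac1{p^\omega(0,e')}\bigr)\bigr]<\infty$. Hypercubes. $\mathfrak{H}_x=\{x+\sum_{i=1}^d\epsilon_ie_i:\epsilon_i\in\{0,1\}\}$, $\mathfrak{H}=\mathfrak{H}_0$; these are the unit hypercubes of $\mathbb{Z}^d$. $\overline{\mathfrak{H}}_0$ is the set of unit hypercubes containing $0$. For a unit hypercube $\mathcal{C}$ and $x,y\in\mathcal{C}$, set $$Q_y^{\mathcal{C}}=\max_{z\in\partial_y\mathcal{C}}p^\omega(y,z-y),\qquad \widetilde Q_{x,y}^{\mathcal{C}}=P_x^\omega\bigl[T_{\partial\mathcal{C}}<T_x^+,\ X_{T_{\partial\mathcal{C}}}\in\partial_y\mathcal{C}\bigr].$$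 Marked Markovian hypercube. A hypercube discovered in a Markovian fashion is a map $h:\Omega\to\overline{\mathfrak{H}}_0$ of the form $h(\omega)=\{f_0(\omega),\dots,f_{2^d-1}(\omega)\}$, with $f_i:\Omega\to\mathbb{Z}^d$ such that: $f_0=0$ $\mathbf{P}$-a.s.; each $f_{i+1}$ is measurable with respect to $\{p^\omega(x,\cdot):x\in\{f_0(\omega),\dots,f_i(\omega)\}\}$ (i.e. $f_{i+1}$ is determined measurably by the already discovered sites and the transition probabilities at these sites); $f_{i+1}(\omega)\in\partial\{f_0(\omega),\dots,f_i(\omega)\}$; and for each $i$, $\mathbf{P}$-a.s. there is $H(\omega)\in\overline{\mathfrak{H}}_0$ with $\{f_0(\omega),\dots,f_i(\omega)\}\subset H(\omega)$. Let $x_0(\omega)$ be the unique point with $h(\omega)=\{x_0(\omega)+y:y\in\mathfrak{H}\}$. A marked Markovian hypercube is a couple $(h(\omega),(\alpha_x(\omega))_{x\in\mathfrak{H}})$ with $h$ a hypercube discovered in a Markovian fashion and each $\alpha_x:\Omega\to\mathbb{R}^+=[0,\infty)$ measurable with respect to $\{p^\omega(y,\cdot):y\in h(\omega)\}$ (i.e. determined measurably by $h(\omega)$ and the transition probabilities at the sites of $h(\omega)$). Condition $(K)_1$: (1) there exist $\gamma_x\in\mathbb{R}^+$, $x\in\mathfrak{H}$, with $\mathbf{E}[(Q_x^{\mathfrak{H}})^{-\gamma_x}]<\infty$ for all $x\in\mathfrak{H}$; (2) there exists a marked Markovian hypercube $(h(\omega),(\alpha_x(\omega))_{x\in\mathfrak{H}})$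 with $\mathbf{E}\bigl[\prod_{x\in\mathfrak{H}}(\widetilde Q_{0,x_0(\omega)+x}^{h(\omega)})^{-\alpha_x(\omega)}\bigr]<\infty$; (3) there exists $\varepsilon'>0$ such that $\sum_{x\in\mathfrak{H}}(\gamma_x\wedge\alpha_x(\omega))\ge1+\varepsilon'$, $\mathbf{P}$-a.s.
   Formalization: Condition (T) is claimed only for ε ≠ 1/2: at ε = 1/2 the environment law is invariant under e ↦ −e, so the walk has no preferred direction and (T) fails. The claims on (K)_1, (E')_1 and (E)_0 keep the full range of ε. *)

(* Defs.v *)
From HB Require Import structures.
From mathcomp Require Import all_boot all_order all_algebra.
From mathcomp Require Import all_classical all_reals all_analysis.

Set Implicit Arguments.
Unset Strict Implicit.
Unset Printing Implicit Defensive.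

Import Order.TTheory GRing.Theory Num.Theory.
Import numFieldNormedType.Exports.

Local Open Scope classical_set_scope.
Local Open Scope ring_scope.

HB.instance Definition _ := isPointed.Build int 0.

(* Directions are indexed by 'I_(d + d): i < d stands for e_{i+1}, and d + i
   for e_{i+1+d} = - e_{i+1}. *)
Notation site d := 'rV[int]_d (only parsing).
Notation dir d := 'I_(d + d) (only parsing).

Section Lattice.
Variable d : nat.

Definition evec (e : dir d) : site d :=
  match fintype.split e with
  | inl i => delta_mx 0 i
  | inr i => - delta_mx 0 i
  end.

Definition opp_dir (e : dir d) : dir d :=
  match fintype.split e with
  | inl i => rshift d i
  | inr i => lshift d i
  end.

Definition adj (x y : site d) : Prop := \sum_(i < d) `|x 0 i - y 0 i| = 1.

Definition bdry (V : set (site d)) : set (site d) :=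
  [set x | ~ V x /\ exists2 y, V y & adj x y].

Definition bdry_at (A : set (site d)) (x : site d) : set (site d) :=
  [set y | bdry A y /\ adj x y].

(* The points of the hypercube at the origin are indexed by their coordinates
   in {0, 1}^d. *)
Definition corner_idx := {ffun 'I_d -> bool}.

Definition vertex (a : corner_idx) : site d := \row_i (a i : nat)%:Z.

Definition unit_cube (x : site d) : set (site d) :=
  [set x + vertex a | a in setT].

Definition cubes_at0 : set (set (site d)) :=
  [set C | (exists x, C = unit_cube x) /\ C 0].

(* The x with C = unit_cube x (junk value 0 if C is not a unit hypercube). *)
Definition base_point (C : set (site d)) : site d :=
  xget 0 [set x | C = unit_cube x].

End Lattice.

Section Environment.
Variables (R : realType) (d : nat).

(* The guard 0 < d matters only in dimension 0, where the sum is empty: it keeps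
   the type inhabited, as required by measurableType. *)
Definition is_transition (p : {ffun dir d -> R}) : bool :=
  [forall e, 0 <= p e] && ((0 < d)%N ==> (\sum_e p e == 1)).

Definition simplex := {p : {ffun dir d -> R} | is_transition p}.

Lemma uniform_is_transition : is_transition [ffun=> ((d + d)%:R)^-1].
Proof.
apply/andP; split.
  by apply/forallP => e; rewrite ffunE invr_ge0 ler0n.
apply/implyP => d0; under eq_bigr do rewrite ffunE.
by rewrite sumr_const card_ord -[_ *+ _]mulr_natl divff// pnatr_eq0 addn_eq0
  andbb -lt0n.
Qed.

HB.instance Definition _ := Choice.on simplex.
HB.instance Definition _ := isPointed.Build simplex
  (exist _ [ffun=> ((d + d)%:R)^-1] uniform_is_transition).

Definition simplex_cyl : set (set simplex) :=
  [set A | exists e (B : set R), measurable B /\ A = [set p : simplex | B (sval p e)]].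

Definition msimplex := g_sigma_algebraType simplex_cyl.

Definition env_cyl : set (set (site d -> simplex)) :=
  [set A | exists x (B : set msimplex), measurable B /\ A = [set w : site d -> simplex | B (w x)]].

Definition env := g_sigma_algebraType env_cyl.

Definition prob_at (w : env) (x : site d) (e : dir d) : R := sval (w x) e.

Definition iid_env (P : probability env R) : Prop :=
  (forall (s : seq (site d)) (A : site d -> set msimplex),
      uniq s -> (forall x, measurable (A x)) ->
      P [set w | forall x, x \in s -> A x (w x)] =
      (\prod_(x <- s) P [set w | A x (w x)])%E) /\
  (forall (x : site d) (A : set msimplex), measurable A ->
      P [set w | A (w x)] = P [set w | A (w 0)]).

Definition path_cyl : set (set (nat -> site d)) :=
  [set A | exists n x, A = [set X | X n = x]].

Definition walk := g_sigma_algebraType path_cyl.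

Definition is_quenched_law (w : env) (x : site d) (Q : probability walk R) :
    Prop :=
  Q [set X | X 0%N = x] = 1%E /\
  (forall (n : nat) (s : nat -> site d) (e : dir d),
      Q [set X | (forall k, (k <= n)%N -> X k = s k) /\ X n.+1 = s n + evec e]
      = (Q [set X | forall k, (k <= n)%N -> X k = s k]
         * (prob_at w (s n) e)%:E)%E).

Definition annealed (P : probability env R)
    (Pq : env -> site d -> probability walk R) (A : set walk) : \bar R :=
  (\int[P]_w Pq w 0%R A)%E.

Definition hit_time (A : set (site d)) (X : walk) : \bar R :=
  ereal_inf [set n%:R%:E | n in [set n | A (X n)]].

Definition exit_time (A : set (site d)) (X : walk) : \bar R := hit_time (~` A) X.

Definition return_time (x : site d) (X : walk) : \bar R :=
  ereal_inf [set n%:R%:E | n in [set n | (1 <= n)%N /\ X n = x]].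

(* X_t belongs to B, for a random time t (in particular t is finite). *)
Definition at_time (t : \bar R) (X : walk) (B : set (site d)) : Prop :=
  exists2 n, t = n%:R%:E & B (X n).

Definition dotp (x : site d) (l : 'rV[R]_d) : R :=
  \sum_(i < d) (x 0 i)%:~R * l 0 i.

Definition sphere : set 'rV[R]_d := [set l | \sum_(i < d) l 0 i ^+ 2 = 1].

Definition slab (b : R) (l : 'rV[R]_d) (L : R) : set (site d) :=
  [set x | - (b * L) <= dotp x l <= L].

Definition cond_T_dir (P : probability env R)
    (Pq : env -> site d -> probability walk R) (l : 'rV[R]_d) (b : R) : Prop :=
  exists2 V : set 'rV[R]_d, V `<=` sphere /\ within sphere (nbhs l) V &
    forall l', V l' ->
      (limf_esup (fun L : R => (L^-1)%:E *
         lne (annealed P Pq [set X |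
           at_time (exit_time (slab b l' L) X) X [set y | (dotp y l' < 0)%R]]))
       +oo%R < 0)%E.

Definition cond_T (P : probability env R)
    (Pq : env -> site d -> probability walk R) : Prop :=
  exists2 l, sphere l & forall b, 0 < b -> cond_T_dir P Pq l b.

(* x^{-a}; in contrast with x `^ (- a), it is +oo for x = 0 < a. *)
Definition invpow (x : \bar R) (a : R) : \bar R := (x^-1 `^ a)%E.

Definition cond_E0 (P : probability env R) : Prop :=
  forall e : dir d, exists2 eta : R, 0 < eta &
    (\int[P]_w invpow (prob_at w 0%R e)%:E eta < +oo)%E.

Definition cond_E'1 (P : probability env R) : Prop :=
  exists2 phi : dir d -> R, (forall e, 0 < phi e) &
    2 * (\sum_e phi e) - sup (range (fun e => phi e + phi (opp_dir e))) > 1 /\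
    forall e, (\int[P]_w
      expeR (\sum_(e' | e' != e) (phi e')%:E * lne ((prob_at w 0%R e')%:E^-1))
      < +oo)%E.

Definition Qmax (C : set (site d)) (y : site d) (w : env) : R :=
  \big[Num.max/0]_(e : dir d | `[< bdry_at C y (y + evec e) >]) prob_at w y e.

Definition Qtilde (Pq : env -> site d -> probability walk R)
    (C : set (site d)) (x y : site d) (w : env) : \bar R :=
  Pq w x [set X | (hit_time (bdry C) X < return_time x X)%E /\
                  at_time (hit_time (bdry C) X) X (bdry_at C y)].

(* The sigma-algebra generated by the random sites g i, i in D, together with
   the transition probabilities at these sites. *)
Definition revealed (I : Type) (D : set I) (g : I -> env -> site d) :
    set (set env) :=
  <<s [set A | exists2 i, D i &
        (exists x, A = [set w | g i w = x]) \/
        (exists e (B : set R), measurable B /\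
           A = [set w | B (prob_at w (g i w) e)])] >>.

Definition discovered (f : nat -> env -> site d) (n : nat) (w : env) :
  set (site d) := [set f j w | j in [set j | (j < n)%N]].

Record markovian_cube (P : probability env R) (f : nat -> env -> site d)
    (h : env -> set (site d)) : Prop := MarkovianCube {
  mc_cube : forall w, cubes_at0 (h w) ;
  mc_def : forall w, h w = discovered f (2 ^ d) w ;
  mc_meas0 : forall x, measurable [set w | f 0%N w = x] ;
  mc_start : {ae P, forall w, f 0%N w = 0} ;
  mc_meas : forall i, (i.+1 < 2 ^ d)%N ->
    forall x, revealed [set j | (j < i.+1)%N] f [set w | f i.+1 w = x] ;
  mc_bdry : forall i, (i.+1 < 2 ^ d)%N ->
    forall w, bdry (discovered f i.+1 w) (f i.+1 w) ;
  mc_sub : forall i, (i < 2 ^ d)%N ->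
    {ae P, forall w, exists2 H, cubes_at0 H & discovered f i.+1 w `<=` H}
}.

Record marked_cube (P : probability env R) (h : env -> set (site d))
    (alpha : corner_idx d -> env -> R) : Prop := MarkedCube {
  mk_cube : exists f, markovian_cube P f h ;
  mk_ge0 : forall a w, 0 <= alpha a w ;
  mk_meas : forall a (B : set R), measurable B ->
    revealed setT (fun c w => base_point (h w) + vertex c)
      [set w | B (alpha a w)]
}.

Definition cond_K1 (P : probability env R)
    (Pq : env -> site d -> probability walk R) : Prop :=
  exists (gamma : corner_idx d -> R) (h : env -> set (site d))
         (alpha : corner_idx d -> env -> R),
  [/\ forall a, 0 <= gamma a,
      forall a, (\int[P]_w invpow (Qmax (unit_cube 0%R) (vertex a) w)%:E (gamma a)
                 < +oo)%E,
      marked_cube P h alpha,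
      (\int[P]_w \prod_(a : corner_idx d)
         invpow (Qtilde Pq (h w) 0%R (base_point (h w) + vertex a)%R w) (alpha a w)
       < +oo)%E &
      exists2 eps' : R, 0 < eps' &
        {ae P, forall w,
           1 + eps' <= \sum_(a : corner_idx d) Num.min (gamma a) (alpha a w)}].

Definition p_expl (eps t : R) (k : dir d) : {ffun dir d -> R} :=
  [ffun i : dir d =>
    if i == k then 1 / t
    else if (i < d)%N then
      (1 - eps - (k < d)%N%:R / t) / (d%:R - (k < d)%N%:R)
    else (eps - (d <= k)%N%:R / t) / (d%:R - (d <= k)%N%:R)].

(* The common law of the p(x, .) is the law of p_expl eps T i0 under mu; the
   latter takes values in the simplex only mu-almost surely. *)
Definition is_P_expl (disp : measure_display) (S : measurableType disp)
    (mu : probability S R) (T : S -> R) (i0 : S -> dir d) (eps : R)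
    (P : probability env R) : Prop :=
  iid_env P /\
  forall A : set msimplex, measurable A ->
    P [set w | A (w 0)] =
    mu [set s | exists2 p : simplex, A p & sval p = p_expl eps (T s) (i0 s)].

End Environment.

(* Main.v *)
Require Import Defs.
From mathcomp Require Import all_boot all_order all_algebra.
From mathcomp Require Import all_classical all_reals all_analysis.
From mathcomp Require Import measurable_realfun ring lra.
Import Order.TTheory GRing.Theory Num.Theory.
Import numFieldNormedType.Exports.
Local Open Scope classical_set_scope.
Local Open Scope ring_scope.

(** At every site exactly one of the 2d directions, chosen uniformly, carries
    the small weight 1/T; the weights of all the others stay above a constant
    [kappa] > 0, and the d forward weights always add up to 1 - eps. The four
    conclusions follow from this picture.

    Condition (K)_1 ([two_directions_cond_K1]). Each vertex of a unit hypercube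
    has d >= 2 directions leaving the hypercube and at most one of them is
    small. Hence every Q_x is at least [kappa], and so is the probability of
    leaving the hypercube from its vertex 0 at the very first step. Any moment
    of these quantities is finite, so it suffices to discover the fixed
    hypercube at the origin and to put the whole mark, equal to 2, on the
    vertex 0.

    Failure of (E')_1 ([expl_not_cond_E'1]). If the expectation that leaves out
    a direction e' is finite, restricting it to the event that e <> e' is the
    small direction gives E[T^phi(e)] < oo, by independence of T and i_0.
    Since E[T^(1/4d)] = oo, every phi(e) is below 1/(4d), so that twice their
    sum is below 1.

    Condition (T) ([constant_drift_cond_T]). The drift along (1, ..., 1) is
    1 - 2 eps at every site, whatever the environment, and it is nonzero for
    eps <> 1/2. For all directions close to the one in which this drift points,
    the exponential, with a small rate, of minus the projected position is
    therefore a quenched supermartingale, and the maximal inequality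
    ([quenched_maximal_ineq]) bounds the probability of a backward exit by an
    exponential in L, uniformly in the environment.

    Condition (E)_0 ([expl_cond_E0]). A weight is 1/T or at least [kappa], so
    its inverse moment of order 1/(8d) is at most a constant plus E[T^(1/8d)].

    Statements about the environment are transferred from the variables T and
    i_0 by the equality of laws at one site ([law_site0]) and, for almost sure
    statements, by stationarity over the countably many sites
    ([ae_environment]). *)

(** * Integration *)

Section Integration.
Context {disp : measure_display} {S : measurableType disp} {R : realType}.
Variable mu : {measure set S -> \bar R}.

(** The integral of a nonnegative function is the supremum of the integrals of
    the simple functions below it, so it is monotone even where no
    measurability is known. This allows bounding integrals of quenched
    probabilities without studying how they depend on the environment. *)
Lemma le_integral_nonmeasurable (f g : S -> \bar R) :
  (forall x, 0 <= f x)%E -> (forall x, f x <= g x)%E ->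
  (\int[mu]_x f x <= \int[mu]_x g x)%E.
Proof.
move=> f0 fg; have g0 x : (0 <= g x)%E by exact: le_trans (fg x).
rewrite !ge0_integralTE//; apply: ereal_sup_le => _ [h hf <-].
by exists h => // x; exact: le_trans (fg x).
Qed.

(** Reduces to a pointwise bound by making [g] infinite on a null set. *)
Lemma ae_le_integral_nonmeasurable (f g : S -> \bar R) :
  (forall x, 0 <= f x)%E -> (forall x, 0 <= g x)%E -> measurable_fun setT g ->
  {ae mu, forall x, f x <= g x}%E -> (\int[mu]_x f x <= \int[mu]_x g x)%E.
Proof.
move=> f0 g0 mg [N [mN N0 fgN]].
pose g' x := if x \in N then +oo%E else g x.
have mg' : measurable_fun setT g'.
  apply: measurable_fun_ifT => //.
  apply: (measurable_fun_bool true); rewrite setTI.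
  by rewrite (_ : _ @^-1` _ = N)//; apply/seteqP; split => x; [exact: set_mem|exact: mem_set].
have -> : (\int[mu]_x g x = \int[mu]_x g' x)%E.
  apply: ge0_ae_eq_integral => //.
    by move=> x _; rewrite /g'; case: ifP.
  exists N; split => // x /=; rewrite /g'; case: ifPn => [|_ []//].
  by rewrite inE.
apply: le_integral_nonmeasurable => // x.
rewrite /g'; case: ifPn => [_|xN]; first exact: leey.
apply: contrapT => fgx; move: xN; rewrite notin_setE; apply.
exact: fgN.
Qed.

Lemma integral_law {disp' disp'' : measure_display}
    {S' : measurableType disp'} {X : measurableType disp''} (nu : {measure set S' -> \bar R})
    (F : S -> X) (G : S' -> X) (f : X -> \bar R) :
  measurable_fun setT F -> measurable_fun setT G -> measurable_fun setT f ->
  (forall x, 0 <= f x)%E ->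
  (forall A, measurable A -> mu (F @^-1` A) = nu (G @^-1` A)) ->
  (\int[mu]_x f (F x) = \int[nu]_x f (G x))%E.
Proof.
move=> mF mG mf f0 FG.
have := @ge0_integral_pushforward _ _ S X R F mF mu setT f measurableT mf (fun y _ => f0 y).
have := @ge0_integral_pushforward _ _ S' X R G mG nu setT f measurableT mf (fun y _ => f0 y).
rewrite !preimage_setT /= => <- <-.
by apply: eq_measure_integral => A mA _; exact: FG.
Qed.

End Integration.

(** Off 0 the inverse is t * (t^2)^(-1), a product of measurable functions, and
    both sides vanish at 0. *)
Lemma measurable_invr {R : realType} : measurable_fun setT (@GRing.inv R).
Proof.
rewrite (_ : GRing.inv = fun t : R => t * (t * t) `^ (-1)); last first.
  apply/funext => t; have [->|t0] := eqVneq t 0; first by rewrite invr0 mul0r.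
  by rewrite powR_inv1 ?sqr_ge0// invfM mulrA mulfV// mul1r.
apply: measurable_funM => //.
apply: (measurableT_comp (measurable_powR _)).
exact: measurable_funM.
Qed.

(** A parameter with finitely many values, each taken on a measurable set, may
    be frozen: the function is a finite sum of functions cut off on these
    sets. *)
Lemma measurable_fun_finsplit {disp : measure_display} {S : measurableType disp}
    {R : realType} {I : finType} (i0 : S -> I) (F : I -> S -> R) :
  (forall i, measurable (i0 @^-1` [set i])) ->
  (forall i, measurable_fun setT (F i)) ->
  measurable_fun setT (fun s => F (i0 s) s).
Proof.
move=> mi mF.
rewrite (_ : (fun s => _) =
    fun s => \sum_i \1_(i0 @^-1` [set i]) s * F i s); last first.
  apply/funext => s; rewrite (bigD1 (i0 s))//= indicE mem_set// mul1r.
  rewrite big1 ?addr0// => i /eqP ii; rewrite indicE memNset ?mul0r//.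
  by move=> /= /esym.
apply: measurable_sum => i; apply: measurable_funM => //.
Qed.

(** * The environment at one site *)

Section OneSite.
Context {R : realType} {d : nat}.

Lemma measurable_site (x : site d) :
  measurable_fun setT (fun w : env R d => w x : msimplex R d).
Proof.
move=> _ B mB; rewrite setTI; apply: sub_sigma_algebra.
by exists x, B.
Qed.

Lemma measurable_weight (e : dir d) :
  measurable_fun setT (fun p : msimplex R d => sval p e).
Proof.
move=> _ B mB; rewrite setTI; apply: sub_sigma_algebra.
by exists e, B.
Qed.

Lemma measurable_to_simplex {disp : measure_display} {S : measurableType disp}
    (G : S -> msimplex R d) :
  (forall e, measurable_fun setT (fun s => sval (G s) e)) ->
  measurable_fun setT G.
Proof.
move=> mG; apply: (@measurability _ _ S (msimplex R d) setT G (@simplex_cyl R d) erefl) => _ [_ [e [B [mB ->]]] <-].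
exact: mG.
Qed.

Lemma weight_ge0 (p : simplex R d) e : 0 <= sval p e.
Proof. by case: p => p /= /andP[/forallP]. Qed.

Lemma weight_sum (p : simplex R d) : (0 < d)%N -> \sum_e sval p e = 1.
Proof. by case: p => p /= /andP[_ /implyP] /[apply] /eqP. Qed.

Lemma weight_le1 (p : simplex R d) e : sval p e <= 1.
Proof.
have d0 : (0 < d)%N by case: d e {p} => [|//] [].
rewrite -(weight_sum p d0) (bigD1 e)//= lerDl sumr_ge0// => i _.
exact: weight_ge0.
Qed.

(** Sends vectors outside the simplex to the uniform weights, so that a random
    vector which is only almost surely a transition vector becomes a
    simplex-valued random variable. *)
Definition simplexify (p : {ffun dir d -> R}) : simplex R d :=
  @insubd _ _ {p : {ffun dir d -> R} | is_transition p}
    (exist (fun q : {ffun dir d -> R} => is_transition q) _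
       (uniform_is_transition R d)) p.

Lemma sval_simplexify (p : {ffun dir d -> R}) :
  is_transition p -> sval (simplexify p) = p.
Proof. by move=> tp; exact: insubdK. Qed.

Section RandomVector.
Context {disp : measure_display} {S : measurableType disp}.
Variable X : S -> {ffun dir d -> R}.
Hypothesis mX : forall e, measurable_fun setT (fun s => X s e).

Lemma measurable_is_transition : measurable [set s | is_transition (X s)].
Proof.
rewrite (_ : [set _ | _] = (\bigcap_(e in [set: dir d]) [set s | 0 <= X s e]) `&`
   [set s | (0 < d)%N ==> (\sum_e X s e == 1)]); last first.
  apply/seteqP; split => s /=.
    by move=> /andP[/forallP X0 ->]; split => // e _ /=; exact: X0.
  by move=> [X0 X1]; apply/andP; split => //; apply/forallP => e; exact: X0.
apply: measurableI.
  apply: fin_bigcap_measurable => [|e _]; first exact: finite_finset.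
  rewrite -[X in measurable X]setTI.
  by apply: measurable_fun_le => //; exact: mX.
case: ltnP => _ /=; last by rewrite (_ : [set _ | _] = setT)//; apply/seteqP.
have mS : measurable_fun setT (fun s => \sum_e X s e) by exact: measurable_sum.
have := mS measurableT [set 1] (measurable_set1 _); rewrite setTI.
by rewrite (_ : _ @^-1` _ = [set s | \sum_e X s e == 1])//; apply/seteqP; split => s /= /eqP.
Qed.

Lemma measurable_simplexify :
  measurable_fun setT (fun s => simplexify (X s) : msimplex R d).
Proof.
apply: measurable_to_simplex => e.
rewrite (_ : (fun s => _) = fun s => if is_transition (X s) then X s e
    else ((d + d)%:R)^-1); last first.
  apply/funext => s; case: ifPn => Xs; first by rewrite sval_simplexify.
  by rewrite /simplexify /insubd insubN//= ffunE.
apply: measurable_fun_ifT => //.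
apply: (measurable_fun_bool true); rewrite setTI.
exact: measurable_is_transition.
Qed.

(** The set on the left is not a preimage, as it only contains points where [X]
    is a transition vector; it differs from the preimage by a null set, and it
    is measurable because being a transition vector is a measurable
    condition. *)
Lemma law_simplexify (mu : probability S R) (A : set (msimplex R d)) :
  measurable A -> {ae mu, forall s, is_transition (X s)} ->
  mu [set s | exists2 p : simplex R d, A p & sval p = X s] =
  mu ((fun s => simplexify (X s) : msimplex R d) @^-1` A).
Proof.
move=> mA [N [mN N0 XN]].
have mG := measurable_simplexify measurableT A mA; rewrite setTI in mG.
rewrite (_ : [set s | _] = (fun s => simplexify (X s)) @^-1` A `&`
    [set s | is_transition (X s)]); last first.
  apply/seteqP; split => s /=.
    move=> [p Ap ps]; have tX : is_transition (X s) by rewrite -ps; case: (p).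
    split => //; suff -> : simplexify (X s) = p by [].
    by apply: val_inj; rewrite /= sval_simplexify.
  move=> [As Xs]; exists (simplexify (X s)) => //; exact: sval_simplexify.
have mI : measurable ((fun s => simplexify (X s)) @^-1` A `&`
    [set s | is_transition (X s)]).
  by apply: measurableI => //; exact: measurable_is_transition.
apply/eqP; rewrite eq_le; apply/andP; split.
  by apply: le_measure; rewrite ?inE//; exact: subIsetl.
rewrite -[leRHS]adde0 -N0.
apply: le_trans (measureU2 _ mI mN).
apply: le_measure; rewrite ?inE//; first exact: measurableU.
move=> s As; have [Xs|Xs] := pselect (is_transition (X s)); first by left.
by right; exact: XN.
Qed.

End RandomVector.
End OneSite.

(** The variable T * 1_E has the law of T, scaled by mu(E), away from 0, and
    [f] does not see the value 0. *)
Lemma integral_indep {disp : measure_display} {S : measurableType disp}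
    {R : realType} (mu : probability S R) (T : S -> R) (E : set S) (c : R)
    (f : R -> \bar R) :
  measurable_fun setT T -> measurable E -> mu E = c%:E ->
  (forall B, measurable B -> mu (T @^-1` B `&` E) = mu (T @^-1` B) * mu E)%E ->
  measurable_fun setT f -> (forall x, 0 <= f x)%E -> f 0 = 0%E ->
  (\int[mu]_s f (T s * \1_E s)%R = c%:E * \int[mu]_s f (T s))%E.
Proof.
move=> mT mE Ec indep mf f0 f00.
have c0 : 0 <= c by rewrite -lee_fin -Ec.
pose Y s := T s * \1_E s.
have mY : measurable_fun setT Y.
  by apply: measurable_funM => //; exact: measurable_indic.
pose D : set R := ~` [set 0].
have mD : measurable D by apply: measurableC; exact: measurable_set1.
have restrictD (X : S -> R) :
    (\int[mu]_s f (X s) = \int[mu]_(s in X @^-1` D) f (X s))%E.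
  rewrite [RHS]integral_mkcond; apply: eq_integral => s _.
  rewrite patchE; case: ifPn => //; rewrite notin_setE /= => XD.
  by have /contrapT -> := XD.
have mfD : measurable_fun D f by exact: measurable_funS mf.
have f0D : {in D, forall y, 0 <= f y}%E by [].
rewrite (restrictD T) (restrictD Y).
have pY := @ge0_integral_pushforward _ _ S R R Y mY mu D f mD mfD f0D.
have pT := @ge0_integral_pushforward _ _ S R R T mT mu D f mD mfD f0D.
rewrite /= in pY pT; rewrite -pY -pT.
rewrite -[c%:E]/((NngNum c0)%:num%:E) -ge0_integral_mscale//.
apply: eq_measure_integral => B mB BD.
transitivity (mu (T @^-1` B) * mu E)%E; last by rewrite Ec muleC.
rewrite -indep// /pushforward.
congr (mu _); apply/seteqP; split => s /=; rewrite /Y indicE.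
  move=> BY; have sE : s \in E.
    by apply: contraT => /negPf sE; have := BD _ BY; rewrite sE mulr0 => /(_ erefl).
  by move: BY; rewrite sE mulr1; split => //; exact: set_mem.
by move=> [BT Es]; rewrite mem_set// mulr1.
Qed.

(** * The explicit transition probabilities *)

Section Explicit.
Context {R : realType} {d : nat}.
Hypothesis d_ge2 : (2 <= d)%N.
Variable eps : R.
Hypothesis eps_gt : 1 / (2 * d + 1)%:R < eps.
Hypothesis eps_lt : eps < (2 * d)%:R / (2 * d + 1)%:R.

(** The worst case of the formulas for the large weights: 1/T is at most
    1/(2d + 1), and there are at most d directions to share the remaining
    mass. *)
Definition kappa : R :=
  Num.min (1 - eps - 1 / (2 * d + 1)%:R) (eps - 1 / (2 * d + 1)%:R) / d%:R.

Let d_gt1 : 1 < d%:R :> R. Proof. by rewrite ltr1n. Qed.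
Let D_gt0 : 0 < (2 * d + 1)%:R :> R. Proof. by rewrite ltr0n addn1. Qed.

Let DV_gt0 : 0 < 1 / (2 * d + 1)%:R :> R. Proof. by rewrite divr_gt0. Qed.

Let eps_lt' : eps < 1 - 1 / (2 * d + 1)%:R.
Proof.
apply: lt_le_trans eps_lt _.
rewrite lerBrDr -mulrDl -[X in _ + X]/(1%:R) -natrD divff// gt_eqF//.
Qed.

Lemma kappa_gt0 : 0 < kappa.
Proof.
rewrite divr_gt0 ?(lt_trans _ d_gt1)// lt_min.
by apply/andP; split; have := eps_lt'; have := eps_gt; lra.
Qed.

Section FixedBad.
Variables (t : R) (k : dir d).
Hypothesis t_ge : (2 * d + 1)%:R <= t.

Let tV_le : 1 / t <= 1 / (2 * d + 1)%:R.
Proof. by rewrite !div1r lef_pV2// posrE// (lt_le_trans D_gt0). Qed.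
Let tV_ge0 : 0 <= 1 / t.
Proof. by rewrite div1r invr_ge0 (le_trans (ltW D_gt0)). Qed.

Lemma p_expl_bad : p_expl eps t k k = 1 / t.
Proof. by rewrite ffunE eqxx. Qed.

Lemma p_expl_ge (i : dir d) : i != k -> kappa <= p_expl eps t k i.
Proof.
move=> /negPf ik; rewrite ffunE ik.
have := tV_le; have := tV_ge0; have := DV_gt0; have := d_gt1.
have := eps_gt; have := eps_lt'; rewrite /kappa.
set K := 1 / (2 * d + 1)%:R => eps1 eps2 dR K0 t0 tK.
have aux (a : R) (b : bool) : K < a ->
    (a - K) / d%:R <= (a - (b : nat)%:R / t) / (d%:R - (b : nat)%:R).
  move=> a_gt; case: b => /=; last first.
    by rewrite mul0r !subr0 ler_pM2r ?invr_gt0; lra.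
  by apply: ler_pM; rewrite ?invr_ge0 ?lef_pV2 ?posrE; lra.
have d0 : 0 < (d%:R : R)^-1 by rewrite invr_gt0; lra.
case: ifP => _; apply: le_trans (aux _ _ _); rewrite ?ler_pM2r//.
- by rewrite ge_min lexx.
- lra.
- by rewrite ge_min lexx orbT.
Qed.

(* Common to the two halves of the directions: [a] is the total mass of the
   half, and [b] tells whether the small weight lies in it, at [j0]. *)
Let halfsum (a : R) (b : bool) (F : 'I_d -> R) (j0 : 'I_d) :
  (forall j, F j = if b && (j == j0) then 1 / t
             else (a - (b : nat)%:R / t) / (d%:R - (b : nat)%:R)) ->
  \sum_j F j = a.
Proof.
have dR := d_gt1.
move=> FE; under eq_bigr do rewrite FE.
case: b {FE} => /=; last first.
  rewrite mul0r !subr0 sumr_const card_ord -[LHS]mulr_natr mulfVK//; lra.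
rewrite (bigD1 j0)//= eqxx (eq_bigr (fun=> (a - 1 / t) / (d%:R - 1))); last first.
  by move=> j /negPf ->.
rewrite sumr_const cardC1 card_ord -[_ *+ d.-1]mulr_natr.
rewrite -subn1 natrB ?(leq_trans _ d_ge2)// mulfVK; lra.
Qed.

Lemma p_expl_forward : \sum_(j < d) p_expl eps t k (lshift d j) = 1 - eps.
Proof.
case: (split_ordP k) => k' ->.
  apply: (@halfsum _ true _ k') => j.
  by rewrite ffunE (inj_eq (@lshift_inj _ _)) /= !ltn_ord.
apply: (@halfsum _ false _ k') => j.
by rewrite ffunE eq_lrshift /= ltn_ord ltnNge leq_addr.
Qed.

Lemma p_expl_backward : \sum_(j < d) p_expl eps t k (rshift d j) = eps.
Proof.
case: (split_ordP k) => k' ->.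
  apply: (@halfsum _ false _ k') => j.
  by rewrite ffunE eq_rlshift /= ltnNge leq_addr /= leqNgt ltn_ord.
apply: (@halfsum _ true _ k') => j.
by rewrite ffunE (inj_eq (@rshift_inj _ _)) /= ltnNge !leq_addr.
Qed.

Lemma p_expl_is_transition : is_transition (p_expl eps t k).
Proof.
apply/andP; split.
  apply/forallP => i; have [->|ik] := eqVneq i k; first by rewrite p_expl_bad.
  exact: le_trans (ltW kappa_gt0) (p_expl_ge _ ik).
apply/implyP => _; rewrite big_split_ord /= p_expl_forward p_expl_backward.
by apply/eqP; lra.
Qed.

End FixedBad.
End Explicit.

Arguments kappa {R} d eps.

(** * Inverse powers *)

Section InversePowers.
Context {R : realType}.

Lemma powR_inv (x a : R) : 0 < x -> (x^-1) `^ a = x `^ (- a).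
Proof.
by move=> x0; rewrite /powR invr_eq0 gt_eqF// lnV ?posrE// mulrN mulNr.
Qed.

Lemma invpow_EFin (x a : R) : 0 < x -> invpow x%:E a = (x `^ (- a))%:E.
Proof. by move=> x0; rewrite /invpow inver gt_eqF// poweR_EFin powR_inv. Qed.

Lemma invpow_ge0 (x : \bar R) (a : R) : (0 <= invpow x a)%E.
Proof. exact: poweR_ge0. Qed.

Lemma invpow0 (x : \bar R) : invpow x 0 = 1%E.
Proof. exact: poweRe0. Qed.

Lemma invpow_le (k a : R) (x : \bar R) : 0 < k -> 0 <= a -> (k%:E <= x)%E ->
  (invpow x a <= (k `^ (- a))%:E)%E.
Proof.
move=> k0 a0 kx; have x0 : (0 <= x)%E by apply: le_trans kx; rewrite lee_fin ltW.
rewrite -invpow_EFin//; apply: gt0_ler_poweR => //.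
- by rewrite in_itv /= leey inve_ge0 x0.
- by rewrite in_itv /= leey inve_ge0 lee_fin ltW.
- by rewrite lee_pV2 ?inE// lee_fin ltW.
Qed.

End InversePowers.

(** * The law of the environment *)

Section ExplicitLaw.
Context {R : realType} {d : nat} {disp : measure_display}.
Context {S : measurableType disp}.
Variables (mu : probability S R) (T : {RV mu >-> R}) (i0 : S -> dir d) (eps : R).
Hypothesis d_ge2 : (2 <= d)%N.
Hypothesis T_ge : {ae mu, forall s, (2 * d + 1)%:R <= T s}.
Hypothesis i0_meas : forall i, measurable (i0 @^-1` [set i]).
Hypothesis eps_gt : 1 / (2 * d + 1)%:R < eps.
Hypothesis eps_lt : eps < (2 * d)%:R / (2 * d + 1)%:R.
Variable P : probability (env R d) R.
Hypothesis P_expl : is_P_expl mu T i0 eps P.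

Let X s := p_expl eps (T s) (i0 s).
Let G s : msimplex R d := simplexify (X s).

Let mX e : measurable_fun setT (fun s => X s e).
Proof.
apply: (@measurable_fun_finsplit _ S R _ i0 (fun k s => p_expl eps (T s) k e)) => // k.
have mTV : measurable_fun setT (fun s => (T s)^-1).
  exact: (measurableT_comp measurable_invr (measurable_funPT T)).
rewrite (_ : (fun s => _) = fun s => if e == k then 1 / T s
    else if (e < d)%N then
      (1 - eps - (k < d)%N%:R / T s) / (d%:R - (k < d)%N%:R)
    else (eps - (d <= k)%N%:R / T s) / (d%:R - (d <= k)%N%:R)); last first.
  by apply/funext => s; rewrite ffunE.
case: (e == k); first exact: measurable_funM.
by case: (e < d)%N; apply: measurable_funM => //; apply: measurable_funB => //;
  exact: measurable_funM.
Qed.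

Let mG : measurable_fun setT G. Proof. exact: measurable_simplexify. Qed.

Let X_transition : {ae mu, forall s, is_transition (X s)}.
Proof. by apply: filterS T_ge => s; exact: p_expl_is_transition. Qed.

Lemma law_site0 (A : set (msimplex R d)) : measurable A ->
  P ((fun w : env R d => w 0 : msimplex R d) @^-1` A) = mu (G @^-1` A).
Proof.
by move=> mA; rewrite -(@law_simplexify R d _ S X mX mu A mA X_transition) -(P_expl.2 A mA).
Qed.

Lemma integral_site0 (f : msimplex R d -> \bar R) :
  measurable_fun setT f -> (forall p, 0 <= f p)%E ->
  (\int[P]_w f (w 0%R) = \int[mu]_s f (G s))%E.
Proof.
move=> mf f0.
exact: (@integral_law _ (env R d) R P _ _ S (msimplex R d) mu (fun w : env R d => w 0) G f (measurable_site 0) mG mf f0 law_site0).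
Qed.

(** Turns a property of all the transition vectors [p_expl] into an almost sure
    property of the random variable that represents the law of one site. *)
Lemma ae_G (Q : msimplex R d -> S -> Prop) :
  (forall (p : msimplex R d) s, (2 * d + 1)%:R <= T s -> sval p = X s -> Q p s) ->
  {ae mu, forall s, Q (G s) s}.
Proof.
move=> QX; apply: filterS2 T_ge X_transition => s Ts Xs.
by apply: QX => //; exact: sval_simplexify.
Qed.

(** The law of every single site charges only [A], and there are countably many
    sites. *)
Lemma ae_environment (A : set (msimplex R d)) : measurable A ->
  (forall (p : msimplex R d) t k, (2 * d + 1)%:R <= t ->
     sval p = p_expl eps t k -> A p) ->
  {ae P, forall w, forall x, A (w x)}.
Proof.
move=> mA Ap.
have mA' : measurable (~` A) by exact: measurableC.
have PA x : P ((fun w : env R d => w x : msimplex R d) @^-1` (~` A)) = 0%E.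
  rewrite (P_expl.1.2 x _ mA') law_site0//.
  apply/negligibleP; first by rewrite -[X in measurable X]setTI; exact: mG.
  have := @ae_G (fun p _ => A p) (fun p s Ts pX => Ap p _ _ Ts pX).
  by rewrite /almost_everywhere /=.
have aeA x : {ae P, forall w, A (w x)}.
  exists ((fun w : env R d => w x : msimplex R d) @^-1` (~` A)); split => //.
  rewrite -[X in measurable X]setTI; exact: measurable_site.
have := @ae_foralln _ _ _ P (fun n w => A (w (odflt 0 (unpickle n)))) (fun n => aeA _).
apply: filterS => w Aw x.
by have := Aw (pickle x); rewrite pickleK.
Qed.


Lemma ae_two_directions : {ae P, forall w, forall x e e', e != e' ->
  kappa d eps <= prob_at w x e \/ kappa d eps <= prob_at w x e'}.
Proof.
pose B e := [set p : msimplex R d | kappa d eps <= sval p e].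
have mB e : measurable (B e).
  rewrite -[X in measurable X]setTI.
  by apply: measurable_fun_le => //; exact: measurable_weight.
pose A := \bigcap_(ee in [set ee : dir d * dir d | ee.1 != ee.2])
  (B ee.1 `|` B ee.2).
have mA : measurable A.
  apply: fin_bigcap_measurable; first exact: finite_finset.
  by move=> ee _; apply: measurableU.
have := @ae_environment A mA; set Q := (X in X -> _) => /(_ _)[].
  move=> p t k t_ge pE [e e'] /= ee'; rewrite /B /= pE.
  have [ek|ek] := eqVneq e k; last by left; exact: p_expl_ge.
  by right; apply: p_expl_ge; rewrite // -ek eq_sym.
move=> N [mN N0 sN]; exists N; split => // w /= nw; apply: sN => /= wA; apply: nw.
by move=> x e e' ee'; exact: (wA x (e, e') ee').
Qed.

Lemma ae_drift : {ae P, forall w, forall x,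
  \sum_(j < d) prob_at w x (lshift d j) = 1 - eps}.
Proof.
pose F (p : msimplex R d) := \sum_(j < d) sval p (lshift d j).
have mF : measurable_fun setT F.
  by apply: measurable_sum => j; exact: measurable_weight.
apply: (@ae_environment (F @^-1` [set 1 - eps])).
  by rewrite -[X in measurable X]setTI; exact: mF.
move=> p t k t_ge pE; rewrite /F /= pE; exact: p_expl_forward.
Qed.

Lemma expl_cond_E0 :
  ('E_mu[(fun s => (T s `^ (1 / (8 * d)%:R))%R)] < +oo)%E -> cond_E0 P.
Proof.
have d0 : (0 < d)%N by exact: leq_trans d_ge2.
rewrite unlock; set eta := 1 / _ => ET e.
have eta0 : 0 < eta by rewrite divr_gt0// ltr0n muln_gt0.
exists eta => //.
pose f (p : msimplex R d) : \bar R :=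
  if sval p e == 0 then +oo%E else (sval p e `^ (- eta))%:E.
have f0 p : (0 <= f p)%E.
  by rewrite /f; case: ifP => _; rewrite ?leey// lee_fin powR_ge0.
have fE (p : msimplex R d) : invpow (sval p e)%:E eta = f p.
  rewrite /f; case: eqVneq => [->|pe0].
    by rewrite /invpow inve0 poweRyr// gt_eqF.
  by rewrite invpow_EFin// lt_neqAle eq_sym pe0 weight_ge0.
have mf : measurable_fun setT f.
  have mw := @measurable_weight R d e.
  apply: measurable_fun_ifT => //; first exact: measurable_fun_eqr.
  apply/measurable_EFinP. exact: (measurableT_comp (measurable_powR _) mw).
under eq_integral do rewrite /prob_at fE.
rewrite integral_site0//.
have mT : measurable_fun setT (fun s => T s `^ eta).
  exact: (measurableT_comp (measurable_powR _) (measurable_funPT T)).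
apply: (@le_lt_trans _ _
    (\int[mu]_s ((kappa d eps `^ (- eta))%:E + (T s `^ eta)%:E))%E).
  apply: ae_le_integral_nonmeasurable => //.
  - by move=> s; rewrite adde_ge0// lee_fin powR_ge0.
  - by apply: emeasurable_funD => //; exact/measurable_EFinP.
  - apply: (@ae_G (fun p s => (f p <= _ + (T s `^ eta)%:E)%E)) => p s Ts pX.
    have k0 := kappa_gt0 d_ge2 _ eps_gt eps_lt.
    have T0 : 0 < T s by apply: lt_le_trans Ts; rewrite ltr0n addn1.
    rewrite -fE pX /X; have [->|es] := eqVneq e (i0 s).
      rewrite p_expl_bad invpow_EFin ?divr_gt0// div1r -powR_inv ?invr_gt0//.
      by rewrite invrK leeDr// lee_fin powR_ge0.
    apply: le_trans (invpow_le _ _ _ k0 (ltW eta0) _) _.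
      by rewrite lee_fin; exact: p_expl_ge.
    by rewrite leeDl// lee_fin powR_ge0.
rewrite ge0_integralD//.
- rewrite integral_cst// lte_add_pinfty// lte_mul_pinfty ?lee_fin ?powR_ge0//.
  exact: le_lt_trans (probability_le1 mu measurableT) (ltry 1).
- by move=> s _; rewrite lee_fin powR_ge0.
- by move=> s _; rewrite lee_fin powR_ge0.
- exact/measurable_EFinP.
Qed.

Hypothesis i0_unif : forall i, mu (i0 @^-1` [set i]) = (1 / (2 * d)%:R)%:E.
Hypothesis i0_indep : forall (B : set R) i, measurable B ->
       mu (T @^-1` B `&` i0 @^-1` [set i]) =
       (mu (T @^-1` B) * mu (i0 @^-1` [set i]))%E.

(** All the terms of the exponent are nonnegative because the weights are at
    most 1, so the term of [e] alone is a lower bound; on the event that [e] is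
    the small direction it produces T^phi(e). *)
Lemma integrable_power_of_E'1 (phi : dir d -> R) (e e' : dir d) :
  (forall i, 0 < phi i) -> e != e' ->
  (\int[P]_w expeR (\sum_(i | i != e') (phi i)%:E *
      lne ((prob_at w 0%R i)%:E^-1)) < +oo)%E ->
  (\int[mu]_s (T s `^ phi e)%:E < +oo)%E.
Proof.
move=> phi0 ee' fin.
have d0 : (0 < d)%N by exact: leq_trans d_ge2.
pose f (p : msimplex R d) : \bar R := (sval p e `^ (- phi e))%:E.
have f0 p : (0 <= f p)%E by rewrite lee_fin powR_ge0.
have mf : measurable_fun setT f.
  apply/measurable_EFinP.
  exact: (measurableT_comp (measurable_powR _) (@measurable_weight R d e)).
have : (\int[mu]_s f (G s) < +oo)%E.
  rewrite -integral_site0//; apply: le_lt_trans fin.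
  apply: le_integral_nonmeasurable => // w; rewrite /f.
  have [pe0|pe0] := eqVneq (sval (w 0) e) 0.
    by rewrite pe0 powR0 ?expeR_ge0// oppr_eq0 gt_eqF.
  have pe_gt0 : 0 < sval (w 0) e by rewrite lt_neqAle eq_sym pe0 weight_ge0.
  have -> : (sval (w 0%R) e `^ (- phi e))%:E =
      expeR ((phi e)%:E * lne ((prob_at w 0%R e)%:E^-1)).
    rewrite inver /prob_at (negPf pe0) lne_EFin ?invr_gt0//= lnV ?posrE//.
    by rewrite /powR (negPf pe0) mulrN mulNr.
  rewrite lee_expeR (bigD1 e)//= leeDl// sume_ge0// => i _.
  rewrite mule_ge0 ?lee_fin ?(ltW (phi0 i))// lne_ge0 inve_ge1.
    by rewrite lee_fin weight_le1.
  by rewrite lee_fin weight_ge0.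
move=> fG.
have mT := measurable_funPT T.
pose g (t : R) : \bar R := (t `^ phi e)%:E.
have mg : measurable_fun setT g.
  by apply/measurable_EFinP; exact: measurable_powR.
have g0 t : (0 <= g t)%E by rewrite lee_fin powR_ge0.
have g00 : g 0 = 0%E by rewrite /g powR0// gt_eqF.
have := @integral_indep _ S R mu T (i0 @^-1` [set e]) _ g mT (i0_meas e)
  (i0_unif e) (fun B => i0_indep B e) mg g0 g00.
rewrite /g => H.
have : ((1 / (2 * d)%:R)%:E * \int[mu]_s (T s `^ phi e)%:E < +oo)%E.
  rewrite -H; apply: le_lt_trans fG.
  apply: ae_le_integral_nonmeasurable => //.
  - by move=> s; rewrite lee_fin powR_ge0.
  - exact: (measurableT_comp mf mG).
  - apply: (@ae_G (fun p s => ((T s * \1_(i0 @^-1` [set e]) s)%R `^ phi e)%:E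
        <= f p)%E) => p s Ts pX.
    have T0 : 0 < T s by apply: lt_le_trans Ts; rewrite ltr0n addn1.
    rewrite indicE; have [se|se] := boolP (s \in _); last first.
      by rewrite mulr0 powR0// gt_eqF.
    move/set_mem: se => /= se.
    by rewrite mulr1 /f pX /X se p_expl_bad div1r -powR_inv ?invr_gt0// invrK.
apply: contraPP => /negP; rewrite -leNgt leye_eq => /eqP ->.
by rewrite gt0_muley// lte_fin divr_gt0// ltr0n muln_gt0.
Qed.

Lemma expl_not_cond_E'1 :
  ('E_mu[(fun s => (T s `^ (1 / (4 * d)%:R))%R)] = +oo)%E -> ~ cond_E'1 P.
Proof.
have d0 : (0 < d)%N by exact: leq_trans d_ge2.
rewrite unlock => ET [phi phi0 [phi1 phi2]].
have phi_lt e : phi e < 1 / (4 * d)%:R.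
  rewrite ltNge; apply/negP => phie.
  have [e' ee'] : exists e' : dir d, e != e'.
    exists (opp_dir e); rewrite /opp_dir.
    by case: (split_ordP e) => j ->; rewrite ?eq_lrshift ?eq_rlshift.
  have := integrable_power_of_E'1 _ _ _ phi0 ee' (phi2 e').
  rewrite ltNge => /negP; apply; rewrite -ET.
  apply: ae_le_integral_nonmeasurable.
  - by move=> s; rewrite lee_fin powR_ge0.
  - by move=> s; rewrite lee_fin powR_ge0.
  - apply/measurable_EFinP.
    exact: (measurableT_comp (measurable_powR _) (measurable_funPT T)).
  - apply: filterS T_ge => s Ts; rewrite lee_fin ler_powR//.
    by apply: le_trans Ts; rewrite ler1n addn1.
have sup0 : 0 <= sup (range (fun e => phi e + phi (opp_dir e))).
  have e : dir d by exact: (lshift d (Ordinal d0)).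
  apply: (@le_trans _ _ (phi e + phi (opp_dir e))).
    by rewrite addr_ge0// ltW.
  apply: sup_upper_bound; last by exists e.
  split; first by exists (phi e + phi (opp_dir e)), e.
  exists (1 / (4 * d)%:R + 1 / (4 * d)%:R) => _ [i _ <-].
  by rewrite lerD// ltW.
have : \sum_e phi e <= \sum_(e : dir d) 1 / (4 * d)%:R.
  by apply: ler_sum => e _; exact: ltW.
rewrite sumr_const card_ord -[leRHS]mulr_natr => sum_le.
have : (1 / (4 * d)%:R) * (d + d)%:R = 1 / 2 :> R.
  by rewrite !natrM natrD; field; rewrite pnatr_eq0 -lt0n.
by move: phi1 sum_le sup0; lra.
Qed.

End ExplicitLaw.

(** * Unit vectors *)

Section UnitVectors.
Context {d : nat}.

Lemma evec_lshift (j : 'I_d) : evec (lshift d j) = delta_mx 0 j.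
Proof. by rewrite /evec -[lshift d j]/(unsplit (inl j)) unsplitK. Qed.

Lemma evec_rshift (j : 'I_d) : evec (rshift d j) = - delta_mx 0 j.
Proof. by rewrite /evec -[rshift d j]/(unsplit (inr j)) unsplitK. Qed.

Lemma evec_inj : injective (@evec d).
Proof.
have coord (s s' : int) (i j : 'I_d) : s != 0 ->
    s *: delta_mx (0 : 'I_1) i = s' *: delta_mx 0 j -> s = s' /\ i = j.
  move=> s0 /matrixP/(_ 0 i); rewrite !mxE !eqxx /=.
  have [->|ij] := eqVneq i j; first by rewrite !mulr1.
  by rewrite mulr1 mulr0 => /eqP; rewrite (negPf s0).
move=> e e'; case: (split_ordP e) => i ->; case: (split_ordP e') => j ->;
  rewrite ?evec_lshift ?evec_rshift.
- by have := coord 1 1 i j isT; rewrite !scale1r => + eij => /(_ eij)[_ ->].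
- by have := coord 1 (-1) i j isT; rewrite scale1r scaleN1r => + eij => /(_ eij)[].
- by have := coord (-1) 1 i j isT; rewrite scale1r scaleN1r => + eij => /(_ eij)[].
- by have := coord (-1) (-1) i j isT; rewrite !scaleN1r => + eij => /(_ eij)[_ ->].
Qed.

End UnitVectors.

(** * Events of the walk *)

Section WalkEvents.
Context {R : realType} {d : nat}.
Implicit Types (A B : set (site d)) (X : walk d).

Lemma measurable_walk_in (n : nat) B : measurable [set X : walk d | B (X n)].
Proof.
rewrite (_ : [set _ | _] =
    \bigcup_(y : site d) [set X : walk d | B y /\ X n = y]); last first.
  by apply/seteqP; split => X /= => [BX|[y _ /= [By ->]]//]; exists (X n).
apply: countable_bigcupT_measurable => [|y]; first exact: countableP.
have [By|nBy] := pselect (B y); last first.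
  rewrite (_ : [set _ | _] = set0)//.
  by apply/seteqP; split => X //= [].
apply: sub_sigma_algebra; exists n, y.
by apply/seteqP; split => X //= [].
Qed.

Definition follows (m : nat) (s : nat -> site d) : set (walk d) :=
  [set X | forall k, (k <= m)%N -> X k = s k].

Lemma measurable_follows m s : measurable (follows m s).
Proof.
rewrite (_ : follows m s = \bigcap_(k in [set k | (k <= m)%N])
    [set X : walk d | [set s k] (X k)]); last first.
  by apply/seteqP; split => X /= sX k; exact: sX.
by apply: bigcap_measurableType => k _; exact: measurable_walk_in.
Qed.

(** An infimum of natural numbers equal to a natural number is attained; the
    infimum is +oo for the empty set, which is not a natural number. *)
Lemma hit_timeP (A : set (site d)) (X : walk d) (n : nat) :
  hit_time R A X = n%:R%:E :> \bar R <->
  A (X n) /\ forall k, (k < n)%N -> ~ A (X k).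
Proof.
have first_hit m : A (X m) -> (forall k, (k < m)%N -> ~ A (X k)) ->
    hit_time R A X = m%:R%:E :> \bar R.
  move=> Am Ak; apply/eqP; rewrite eq_le; apply/andP; split.
    by apply: ereal_inf_lbound; exists m.
  apply: le_ereal_inf_tmp => _ [k Ak' <-]; rewrite lee_fin ler_nat leqNgt.
  by apply/negP => /Ak.
split => [hn|[An Ak]]; last exact: first_hit.
have [[m Am]|noA] := pselect (exists m, A (X m)).
  have exA : exists m, `[< A (X m) >] by exists m; apply/asboolP.
  case: (ex_minnP exA) => k /asboolP Ak kmin.
  have ltk j : (j < k)%N -> ~ A (X j).
    by move=> jk /asboolP/kmin; rewrite leqNgt jk.
  have := first_hit k Ak ltk; rewrite hn => -[/eqP].
  by rewrite eqr_nat => /eqP ->.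
exfalso; move: hn; rewrite /hit_time.
have -> : [set n | A (X n)] = set0.
  by apply/seteqP; split => // m Am; apply: noA; exists m.
by rewrite image_set0 ereal_inf0.
Qed.

(** Turns the comparison of the two random times into a condition on finitely
    many positions, hence a measurable one. *)
Lemma return_time_gt (x : site d) (X : walk d) (n : nat) :
  (n%:R%:E < return_time R x X :> \bar R)%E <->
  forall k, (1 <= k <= n)%N -> X k <> x.
Proof.
split => [nr k /andP[k1 kn] Xk|nX].
  move: nr; rewrite ltNge => /negP; apply.
  apply: ge_ereal_inf; exists k%:R%:E; first by exists k.
  by rewrite lee_fin ler_nat.
apply: (@lt_le_trans _ _ n.+1%:R%:E); first by rewrite lte_fin ltr_nat.
apply: le_ereal_inf_tmp => _ [k [k1 Xk] <-]; rewrite lee_fin ler_nat ltnNge.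
by apply/negP => kn; apply: (nX k) => //; rewrite k1.
Qed.

Lemma measurable_hit_time A (n : nat) :
  measurable [set X : walk d | hit_time R A X = n%:R%:E :> \bar R].
Proof.
rewrite (_ : [set _ | _] = [set X : walk d | A (X n)] `&`
    \bigcap_(k in [set k | (k < n)%N]) [set X : walk d | (~` A) (X k)]).
  apply: measurableI; first exact: measurable_walk_in.
  by apply: bigcap_measurableType => k _; exact: measurable_walk_in.
by apply/seteqP; split => X /= /hit_timeP.
Qed.

Lemma measurable_at_hit A B :
  measurable [set X : walk d | at_time (hit_time R A X : \bar R) X B].
Proof.
rewrite (_ : [set _ | _] = \bigcup_n ([set X : walk d | hit_time R A X = n%:R%:E :> \bar R]
    `&` [set X : walk d | B (X n)])).
  apply: bigcupT_measurable => n; apply: measurableI.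
    exact: measurable_hit_time.
  exact: measurable_walk_in.
by apply/seteqP; split => X /= [n] => [hn Bn|_ [hn Bn]]; exists n.
Qed.

Lemma measurable_at_hit_before_return A B (x : site d) :
  measurable [set X : walk d |
    (hit_time R A X < return_time R x X :> \bar R)%E /\
    at_time (hit_time R A X : \bar R) X B].
Proof.
rewrite (_ : [set _ | _] = \bigcup_n (
    [set X : walk d | hit_time R A X = n%:R%:E :> \bar R] `&`
    [set X : walk d | B (X n)] `&`
    \bigcap_(k in [set k | (1 <= k <= n)%N])
      [set X : walk d | (~` [set x]) (X k)])).
  apply: bigcupT_measurable => n; apply: measurableI.
    apply: measurableI; first exact: measurable_hit_time.
    exact: measurable_walk_in.
  by apply: bigcap_measurableType => k _; exact: measurable_walk_in.
apply/seteqP; split => X /=.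
  move=> [hr [n hn Bn]]; exists n => //; split => //.
  by move: hr; rewrite hn => /return_time_gt.
move=> [n _ [[hn Bn] nx]]; split; last by exists n.
by rewrite hn; exact/return_time_gt.
Qed.

End WalkEvents.

(** * Maximal inequality *)

Section Supermartingale.
Context {R : realType} {d : nat}.
Hypothesis d_gt0 : (0 < d)%N.
Variables (w : env R d) (x : site d) (Q : probability (walk d) R).
Hypothesis Q_law : is_quenched_law w x Q.

Let step m s (e : dir d) : set (walk d) :=
  follows m s `&` [set X : walk d | X m.+1 = s m + evec e].

Let extend m (s : nat -> site d) (e : dir d) (k : nat) : site d :=
  if (k <= m)%N then s k else s m + evec e.

Let stepE m s e : step m s e = follows m.+1 (extend m s e).
Proof.
apply/seteqP; split => X /=.
  move=> [sX Xm] k; rewrite leq_eqVlt /extend ltnS => /predU1P[->|km].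
    by rewrite ltnn.
  by rewrite km sX.
move=> sX; split => [k km|].
  by rewrite sX ?(leq_trans km)// /extend km.
by rewrite /= sX// /extend ltnn.
Qed.

Let Q_step m s e : (Q (step m s e) = Q (follows m s) * (prob_at w (s m) e)%:E)%E.
Proof. by rewrite -(Q_law.2 m s e). Qed.

Let mstep m s e : measurable (step m s e).
Proof. by rewrite stepE; exact: measurable_follows. Qed.

Let Q_steps m s (A : set (walk d)) : measurable A ->
  (Q (\bigcup_e (step m s e `&` A)) = \sum_e Q (step m s e `&` A))%E.
Proof.
move=> mA; rewrite measure_fin_bigcup//.
- rewrite (@fsbigE _ _ _ _ _ (index_enum _)) ?index_enum_uniq//.
    by apply: eq_bigl => e; exact: mem_set.
  by move=> e _; rewrite mem_index_enum.
- exact: finite_finset.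
- move=> e e' _ _ [X [[[_ Xe] _] [[_ Xe'] _]]]; apply: evec_inj.
  by move: Xe; rewrite /= Xe' => /addrI.
- by move=> e _; exact: measurableI.
Qed.

(** The extensions of a path by the unit vectors carry all the mass of the path,
    as the weights at its endpoint sum to 1. So the walk almost surely moves to
    a neighbour, although the definition of its law only prescribes the
    probabilities of nearest-neighbour steps. *)
Lemma quenched_one_step m s (A : set (walk d)) : measurable A ->
  (Q (follows m s `&` A) <= \sum_e Q (follows m.+1 (extend m s e) `&` A))%E.
Proof.
move=> mA; set F := follows m s.
have mF : measurable F by exact: measurable_follows.
pose U := \bigcup_e step m s e.
have mU : measurable U.
  by apply: fin_bigcup_measurable => // ; exact: finite_finset.
have QU : Q U = Q F.
  have := Q_steps m s setT measurableT.
  under eq_bigcupr do rewrite setIT.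
  under eq_bigr do rewrite setIT Q_step.
  rewrite -ge0_sume_distrr => [|e _]; last by rewrite lee_fin weight_ge0.
  by rewrite sumEFin weight_sum// mule1.
have QFU : Q (F `\` U) = 0%E.
  transitivity (Q F - Q U)%E; last by rewrite QU subee// fin_num_measure.
  rewrite measureD//; last exact: le_lt_trans (probability_le1 Q mF) (ltry 1).
  by rewrite setIidr// => X [e _] [].
have -> : (\sum_e Q (follows m.+1 (extend m s e) `&` A) = Q (U `&` A))%E.
  rewrite setI_bigcupl Q_steps//.
  by apply: eq_bigr => e _; rewrite stepE.
have mUA : measurable (U `&` A) by exact: measurableI.
have mFU : measurable (F `\` U) by exact: measurableD.
rewrite -[leRHS]adde0 -QFU; apply: le_trans (measureU2 _ mUA mFU).
apply: le_measure; rewrite ?inE; [exact: measurableI|exact: measurableU|].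
move=> X [FX AX]; have [UX|UX] := pselect (U X); first by left.
by right.
Qed.

Variables (B : set (site d)) (f : site d -> R).
Hypothesis f_ge0 : forall y, 0 <= f y.
Hypothesis f_ge1 : forall y, B y -> 1 <= f y.
Hypothesis f_super : forall y, \sum_e prob_at w y e * f (y + evec e) <= f y.

Let hits m n : set (walk d) := [set X | exists2 k, (k <= n)%N & B (X (m + k)%N)].

Let mhits m n : measurable (hits m n).
Proof.
rewrite (_ : hits m n = \bigcup_(k in [set k | (k <= n)%N])
    [set X : walk d | B (X (m + k)%N)])//.
by apply: bigcup_measurable => k _; exact: measurable_walk_in.
Qed.

(** The optional stopping bound conditionally on the path up to time [m], by
    induction on the horizon: either the walk already is in [B], where [f] is
    at least 1, or it makes one step and [f] decreases on average. *)
Lemma quenched_hits_le m n s :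
  (Q (follows m s `&` hits m n) <= Q (follows m s) * (f (s m))%:E)%E.
Proof.
elim: n m s => [|n IHn] m s.
all: have mF := @measurable_follows d m s.
all: have [Bs|nBs] := pselect (B (s m)).
1,3: apply: (@le_trans _ _ (Q (follows m s))).
1,3: by apply: le_measure; rewrite ?inE;
  [exact: measurableI|exact: mF|exact: subIsetl].
1,2: by rewrite -[leLHS]mule1 lee_wpmul2l ?lee_fin ?f_ge1.
  rewrite (_ : _ `&` _ = set0) ?measure0 ?mule_ge0 ?lee_fin//.
  apply/seteqP; split => // X [sX [k]]; rewrite leqn0 => /eqP ->.
  by rewrite addn0 sX.
apply: le_trans (quenched_one_step _ _ _ (mhits _ _)) _.
apply: (@le_trans _ _ (\sum_e Q (follows m s) *
    (prob_at w (s m) e * f (s m + evec e))%:E)%E).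
  apply: lee_sum => e _.
  apply: (@le_trans _ _ (Q (follows m.+1 (extend m s e) `&` hits m.+1 n))).
    apply: le_measure; rewrite ?inE; [|
      |move=> X [sX [k kn Bk]]; split => //].
    - by apply: measurableI => //; exact: measurable_follows.
    - by apply: measurableI => //; exact: measurable_follows.
    case: k kn Bk => [_|k kn Bk]; last by exists k; rewrite ?addSnnS.
    by rewrite addn0 sX// /extend leqnn.
  apply: le_trans (IHn _ _) _.
  by rewrite {2}/extend ltnn -stepE Q_step EFinM muleA.
rewrite -ge0_sume_distrr => [|e _]; last first.
  by rewrite lee_fin mulr_ge0// weight_ge0.
by rewrite sumEFin lee_wpmul2l// lee_fin.
Qed.

Lemma quenched_maximal_ineq :
  (Q [set X : walk d | exists n, B (X n)] <= (f x)%:E)%E.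
Proof.
pose F := follows 0 (fun=> x).
have mF : measurable F by exact: measurable_follows.
have FE : F = [set X : walk d | X 0%N = x].
  apply/seteqP; split => X /= FX; first exact: FX.
  by move=> k; rewrite leqn0 => /eqP ->.
have QF : Q F = 1%E by rewrite FE Q_law.1.
pose H n := F `&` hits 0 n.
have mH n : measurable (H n) by exact: measurableI.
have mUH : measurable (\bigcup_n H n) by exact: bigcupT_measurable.
have QH : (Q (\bigcup_n H n) <= (f x)%:E)%E.
  have ndH : nondecreasing_seq H.
    move=> n k nk; apply/subsetPset => X [FX [j jn Bj]]; split => //.
    by exists j => //; exact: leq_trans nk.
  have cvH := @nondecreasing_cvg_mu _ _ _ Q H mH mUH ndH.
  rewrite -(cvg_lim (@ereal_hausdorff _) cvH).
  apply: lime_le; first by apply/cvg_ex; exists (Q (\bigcup_n H n)).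
  apply: nearW => n; apply: le_trans (quenched_hits_le 0 n (fun=> x)) _.
  by rewrite -/F QF mul1e.
have mCF : measurable (~` F) by exact: measurableC.
have QCF : Q (~` F) = 0%E by rewrite probability_setC// QF subee.
rewrite -[leRHS]adde0 -QCF.
apply: (@le_trans _ _ (Q (\bigcup_n H n) + Q (~` F))%E); last by rewrite leeD2r.
apply: le_trans (measureU2 _ mUH mCF).
apply: le_measure; rewrite ?inE; last first.
- move=> X [n Bn]; have [FX|FX] := pselect (F X); last by right.
  by left; exists n => //; split => //; exists n.
- exact: measurableU.
rewrite (_ : [set _ | _] = \bigcup_n [set X : walk d | B (X n)]).
  by apply: bigcupT_measurable => n; exact: measurable_walk_in.
by apply/seteqP; split => X [n]; exists n.
Qed.

End Supermartingale.

(** * Ballisticity *)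

Section ExponentialMoments.
Context {R : realType}.

(** From 1 + t <= exp t, since (1 + t) (1 - t + 2 t^2) = 1 + t^2 (1 + 2 t). *)
Lemma expRN_le (t : R) : - (1 / 2) <= t -> expR (- t) <= 1 - t + 2 * t ^+ 2.
Proof.
move=> t_ge; have t1 : 0 < 1 + t by lra.
rewrite expRN; apply: (@le_trans _ _ (1 + t)^-1).
  by rewrite lef_pV2 ?posrE ?expR_gt0// expR_ge1Dx.
rewrite -[leLHS]mul1r ler_pdivrMr//.
have : 0 <= t ^+ 2 * (1 + 2 * t) by rewrite mulr_ge0 ?sqr_ge0//; lra.
by rewrite expr2; lra.
Qed.

(** To second order in delta, the moment is at most
    1 - (delta/2) * delta + 2 * (delta/2)^2 = 1: the rate delta/2 is the
    largest one for which the quadratic error is absorbed by the drift. *)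
Lemma exp_moment_le1 (I : finType) (p a : I -> R) (delta : R) :
  (forall i, 0 <= p i) -> \sum_i p i = 1 -> (forall i, `|a i| <= 1) ->
  0 < delta -> delta <= \sum_i p i * a i ->
  \sum_i p i * expR (- (delta / 2 * a i)) <= 1.
Proof.
move=> p0 p1 a1 delta0 drift.
have delta_le1 : delta <= 1.
  apply: le_trans drift _; rewrite -p1; apply: ler_sum => i _.
  by rewrite ler_piMr// (le_trans (ler_norm _)).
apply: (@le_trans _ _ (\sum_i (p i - delta / 2 * (p i * a i)
    + (delta ^+ 2 / 2) * p i))).
  apply: ler_sum => i _.
  have /andP[a_ge a_le] : -1 <= a i <= 1 by rewrite -ler_norml.
  apply: (@le_trans _ _ (p i * (1 - delta / 2 * a i + 2 * (delta / 2 * a i) ^+ 2))).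
    rewrite ler_wpM2l// expRN_le//.
    have : 0 <= delta * (a i + 1) by rewrite mulr_ge0//; lra.
    by lra.
  have : 0 <= p i * (delta ^+ 2 * (1 - a i ^+ 2)).
    by rewrite mulr_ge0// mulr_ge0 ?sqr_ge0// subr_ge0 -(real_normK (num_real _)) exprn_ile1.
  by rewrite !expr2; lra.
rewrite !big_split /= sumrN -!mulr_sumr p1.
have : 0 <= delta * (\sum_i p i * a i - delta) by rewrite mulr_ge0//; lra.
by rewrite expr2; lra.
Qed.

End ExponentialMoments.

Section Drift.
Context {R : realType} {d : nat}.
Implicit Types (l : 'rV[R]_d) (w : env R d).

Lemma dotpD (x y : site d) l : dotp (x + y) l = dotp x l + dotp y l.
Proof.
rewrite /dotp -big_split; apply: eq_bigr => i _ /=.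
by rewrite mxE intrD mulrDl.
Qed.

Lemma dotp0 l : dotp 0 l = 0.
Proof. by rewrite /dotp big1// => i _; rewrite mxE mul0r. Qed.

Lemma dotp_lshift (j : 'I_d) l : dotp (evec (lshift d j)) l = l 0 j.
Proof.
rewrite evec_lshift /dotp (bigD1 j)//= mxE !eqxx mul1r big1 ?addr0// => i ij.
by rewrite mxE (negPf ij) andbF mul0r.
Qed.

Lemma dotp_rshift (j : 'I_d) l : dotp (evec (rshift d j)) l = - l 0 j.
Proof.
rewrite evec_rshift /dotp (bigD1 j)//= !mxE !eqxx mulN1r big1 ?addr0// => i ij.
by rewrite !mxE (negPf ij) andbF oppr0 mul0r.
Qed.

Lemma dotp_evec_le1 (e : dir d) l : sphere l -> `|dotp (evec e) l| <= 1.
Proof.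
move=> l1; have l_le1 j : `|l 0 j| <= 1.
  rewrite -(@expr_le1 _ 2)// (real_normK (num_real _)) -l1 (bigD1 j)//= lerDl sumr_ge0// => i _.
  exact: sqr_ge0.
by case: (split_ordP e) => j ->; rewrite ?dotp_lshift ?dotp_rshift ?normrN.
Qed.

(** A walk that leaves the slab with a negative projection has gone below
    - b L. The exponential f of minus the projected position, normalised to 1
    at the level - b L, is a supermartingale by [exp_moment_le1], and its value
    at the starting point is the bound. *)
Lemma exit_backwards_le (w : env R d) (Q : probability (walk d) R) l
    (b delta L : R) : (0 < d)%N -> is_quenched_law w 0 Q -> sphere l ->
  0 < delta -> 0 < L ->
  (forall x, delta <= \sum_e prob_at w x e * dotp (evec e) l) ->
  (Q [set X | at_time (exit_time R (slab b l L) X) X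
       [set y | (dotp y l < 0)%R]] <= (expR (- (delta / 2 * b * L)))%:E)%E.
Proof.
move=> d0 Qlaw l1 delta0 L0 drift.
pose B : set (site d) := [set y | dotp y l < - (b * L)].
pose f (y : site d) := expR (- (delta / 2 * (b * L + dotp y l))).
have f0 y : 0 <= f y by exact: expR_ge0.
have f1 y : B y -> 1 <= f y.
  rewrite /B /= => By; rewrite -expR0 ler_expR oppr_ge0 mulr_ge0_le0 ?ltW//.
    by rewrite divr_gt0.
  by rewrite -ltrBDl sub0r.
have fsuper y : \sum_e prob_at w y e * f (y + evec e) <= f y.
  rewrite [leLHS](_ : _ = f y *
      \sum_e prob_at w y e * expR (- (delta / 2 * dotp (evec e) l))); last first.
    rewrite mulr_sumr; apply: eq_bigr => e _.
    by rewrite /f mulrCA -expRD dotpD; congr (_ * expR _); ring.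
  rewrite ler_piMr//; apply: exp_moment_le1 => //.
  - by move=> e; exact: weight_ge0.
  - exact: weight_sum.
  - by move=> e; exact: dotp_evec_le1.
have := quenched_maximal_ineq d0 _ _ _ Qlaw B _ f0 f1 fsuper.
have -> : f 0 = expR (- (delta / 2 * b * L)) by rewrite /f dotp0 addr0 mulrA.
apply: le_trans; apply: le_measure; rewrite ?inE.
- exact: measurable_at_hit.
- rewrite (_ : [set _ | _] = \bigcup_n [set X : walk d | B (X n)]).
    by apply: bigcupT_measurable => n; exact: measurable_walk_in.
  by apply/seteqP; split => X [n]; exists n.
move=> X [n /hit_timeP[nslab _] /= Xl]; exists n; rewrite /B /=.
rewrite ltNge; apply/negP => Xb; apply: nslab; rewrite /slab /=.
by rewrite Xb/= (le_trans (ltW Xl))// ltW.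
Qed.

Lemma uniform_drift_cond_T_dir (P : probability (env R d) R)
    (Pq : env R d -> site d -> probability (walk d) R) (l : 'rV[R]_d)
    (b delta : R) (V : set 'rV[R]_d) :
  (0 < d)%N -> (forall w x, is_quenched_law w x (Pq w x)) ->
  V `<=` @sphere R d -> within (@sphere R d) (nbhs l) V ->
  0 < delta -> 0 < b ->
  {ae P, forall w, forall l', V l' -> forall x,
     delta <= \sum_e prob_at w x e * dotp (evec e) l'} ->
  cond_T_dir P Pq l b.
Proof.
move=> d0 Pq_law Vs Vl delta0 b0 drift.
exists V => // l' Vl'.
have rate0 : 0 < delta / 2 * b by rewrite mulr_gt0// divr_gt0.
apply: (@le_lt_trans _ _ (- (delta / 2 * b))%:E); last by rewrite lte_fin oppr_lt0.
(* The bound holds for every L > 0, not only asymptotically. *)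
apply: ge_ereal_inf.
eexists; first by exists [set L : R | 0 < L] => //; exists 0; split.
apply: ge_ereal_sup => _ [L /= L0 <-].
set a := annealed _ _ _.
have a0 : (0 <= a)%E by apply: integral_ge0.
have a_le : (a <= (expR (- (delta / 2 * b * L)))%:E)%E.
  apply: (@le_trans _ _ (\int[P]_w (cst (expR (- (delta / 2 * b * L)))%:E) w)%E).
    apply: ae_le_integral_nonmeasurable => //.
      by move=> w; rewrite lee_fin expR_ge0.
    apply: filterS drift => w drift_w.
    by apply: exit_backwards_le => //; [exact: Vs|exact: drift_w].
  rewrite integral_cst// -[leRHS]mule1 lee_wpmul2l ?lee_fin ?expR_ge0//.
  exact: probability_le1.
have lne_a : (lne a <= (- (delta / 2 * b * L))%:E)%E.
  rewrite -(expRK (- (delta / 2 * b * L))) -lne_EFin ?expR_gt0//.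
  by rewrite lee_lne// in_itv /= leey ?a0 ?lee_fin ?expR_ge0.
apply: (@le_trans _ _ ((L^-1)%:E * (- (delta / 2 * b * L))%:E)%E).
  by rewrite lee_wpmul2l// lee_fin invr_ge0 ltW.
by rewrite -EFinM lee_fin mulrN mulrCA mulVf ?mulr1// gt_eqF.
Qed.

End Drift.

Section ConditionT.
Context {R : realType} {d : nat}.

(** The direction is the diagonal one, oriented by the sign of 1 - 2 eps, with
    drift 2 [delta]. Changing each coordinate of the direction by at most
    [delta] changes the drift by at most [delta], because the weights sum to
    1. *)
Lemma constant_drift_cond_T (P : probability (env R d) R)
    (Pq : env R d -> site d -> probability (walk d) R) (eps : R) :
  (0 < d)%N -> (forall w x, is_quenched_law w x (Pq w x)) ->
  {ae P, forall w, forall x, \sum_(j < d) prob_at w x (lshift d j) = 1 - eps} ->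
  eps <> 1 / 2 -> cond_T P Pq.
Proof.
move=> d0 Pq_law forward eps_half.
have c0 : 1 - 2 * eps != 0 by apply/eqP; lra.
have sd0 : 0 < Num.sqrt (d%:R : R) by rewrite sqrtr_gt0 ltr0n.
pose v : R := Num.sg (1 - 2 * eps) / Num.sqrt d%:R.
pose delta := `|1 - 2 * eps| / Num.sqrt d%:R / 2.
have delta0 : 0 < delta by rewrite !divr_gt0// normr_gt0.
have v_drift : v * (1 - 2 * eps) = 2 * delta.
  by rewrite /v /delta normrEsg; field; rewrite gt_eqF.
pose l : 'rV[R]_d := const_mx v.
have sl : sphere l.
  rewrite /sphere /= (eq_bigr (fun=> d%:R^-1)).
    by rewrite sumr_const card_ord -[LHS]mulr_natr mulVf// pnatr_eq0 -lt0n.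
  move=> i _; rewrite mxE /v expr_div_n sqr_sqrtr// sqr_sg c0.
  by rewrite mul1r.
pose V : set 'rV[R]_d := [set l' | sphere l' /\ forall j, `|l' 0 j - v| < delta].
exists l => // b b0.
apply: (@uniform_drift_cond_T_dir _ _ _ _ _ _ delta V) => //.
- by move=> l' [].
- apply/nbhs_ballP; exists delta => //= l' ll' sl'; split => // j.
  have llj : `|l 0 j - l' 0 j| < delta by case: ll' => // _ /(_ 0 j).
  by move: llj; rewrite mxE distrC.
apply: filterS forward => w forward_w l' [_ l'v] x.
pose p j := prob_at w x (lshift d j); pose q j := prob_at w x (rshift d j).
have p0 j : 0 <= p j by exact: weight_ge0.
have q0 j : 0 <= q j by exact: weight_ge0.
have sp : \sum_j p j = 1 - eps by exact: forward_w.
have sq : \sum_j q j = eps.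
  have := weight_sum (w x) d0; rewrite big_split_ord /=.
  by rewrite -/(\sum_j p j) -/(\sum_j q j); move: sp; rewrite /p /q /prob_at; lra.
rewrite big_split_ord /=.
apply: (@le_trans _ _ (\sum_j (p j * (v - delta)) + \sum_j (q j * (- v - delta)))).
  by rewrite -!mulr_suml sp sq; move: v_drift; lra.
apply: lerD; apply: ler_sum => j _.
all: have := l'v j; rewrite ltr_norml => /andP[lj1 lj2].
  by rewrite dotp_lshift ler_wpM2l//; lra.
by rewrite dotp_rshift ler_wpM2l//; lra.
Qed.

End ConditionT.

(** * The hypercube at the origin *)

Section Cube.
Context {d : nat}.
Implicit Types (a b : corner_idx d) (x y : site d) (e : dir d).

Lemma adj_evec x e : adj x (x + evec e).
Proof.
rewrite /adj.
have [j ej] : exists j : 'I_d, forall i, `|evec e ord0 i| = ((i == j) : nat)%:Z.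
  case: (split_ordP e) => j ->; exists j => i;
    by rewrite ?evec_lshift ?evec_rshift !mxE eqxx /= ?normrN; case: (i == j).
rewrite (bigD1 j)//= big1 => [|i /negPf ij].
  by rewrite mxE opprD addNKr normrN ej eqxx addr0.
by rewrite mxE opprD addNKr normrN ej ij.
Qed.

Definition outward a (i : 'I_d) : dir d := if a i then lshift d i else rshift d i.

Lemma outward_inj a : injective (outward a).
Proof.
move=> i j; rewrite /outward; case: (a i); case: (a j).
- exact: lshift_inj.
- by move/eqP; rewrite eq_lrshift.
- by move/eqP; rewrite eq_rlshift.
- exact: rshift_inj.
Qed.

Lemma unit_cube0P y : unit_cube 0 y <-> exists a, y = vertex a.
Proof.
split => [[a _ <-]|[a ->]]; exists a => //; by rewrite add0r.
Qed.

(** The [i]-th coordinate becomes 2 or -1. *)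
Lemma outward_bdry a i : bdry_at (unit_cube 0) (vertex a) (vertex a + evec (outward a i)).
Proof.
split; last exact: adj_evec.
split; last first.
  exists (vertex a); first by apply/unit_cube0P; exists a.
  rewrite /adj -[RHS](adj_evec (vertex a) (outward a i)).
  by apply: eq_bigr => j _; rewrite distrC.
move/unit_cube0P => [b /matrixP/(_ 0 i)]; rewrite /outward.
case ai: (a i); rewrite ?evec_lshift ?evec_rshift !mxE !eqxx ai;
  by case: (b i).
Qed.

(** Each hypercube contains the base point of the other, so that the coordinates
    of [x] are in {0, 1} and in {-1, 0}. *)
Lemma unit_cube_inj x : unit_cube 0 = unit_cube x -> x = 0.
Proof.
move=> cx.
have [b xb] : exists b, x = vertex b.
  apply/unit_cube0P; rewrite cx; exists [ffun=> false] => //.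
  by apply/rowP => i; rewrite !mxE ffunE addr0.
have : unit_cube x 0.
  by rewrite -cx; apply/unit_cube0P; exists [ffun=> false]; apply/rowP => i; rewrite !mxE ffunE.
move=> [a _ /matrixP xa]; apply/rowP => i; have := xa 0 i.
by rewrite xb !mxE; case: (b i); case: (a i).
Qed.

Lemma base_point_cube0 : base_point (unit_cube (0 : site d)) = 0.
Proof. by rewrite /base_point; case: xgetP => // x _ /unit_cube_inj. Qed.

Definition origin : corner_idx d := [ffun=> false].

Lemma vertex_origin : vertex origin = 0.
Proof. by apply/rowP => i; rewrite !mxE ffunE. Qed.

Lemma cubes_at0_unit_cube : cubes_at0 (unit_cube (0 : site d)).
Proof.
by split; [exists 0|apply/unit_cube0P; exists origin; rewrite vertex_origin].
Qed.

Lemma vertex_inj : injective (@vertex d).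
Proof.
move=> a b /matrixP ab; apply/ffunP => i; have := ab 0 i.
by rewrite !mxE; case: (a i); case: (b i).
Qed.

(** Visiting the vertices in the order of their binary codes is a way of
    discovering the hypercube site by site while staying connected. *)
Definition binary_corner (n : nat) : corner_idx d := [ffun j : 'I_d => odd (n %/ 2 ^ j)].

Lemma binary_corner0 : binary_corner 0 = origin.
Proof. by apply/ffunP => j; rewrite !ffunE div0n. Qed.

End Cube.

Lemma binary_digits_inj (d m n : nat) : (m < 2 ^ d)%N -> (n < 2 ^ d)%N ->
  (forall j, (j < d)%N -> odd (m %/ 2 ^ j) = odd (n %/ 2 ^ j)) -> m = n.
Proof.
elim: d m n => [|d IHd] m n; first by rewrite expn0 !ltnS !leqn0 => /eqP-> /eqP->.
rewrite expnS => m_lt n_lt digits.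
have digit0 : odd m = odd n by have := digits 0%N isT; rewrite !divn1.
have half : (m %/ 2 = n %/ 2)%N.
  apply: IHd; rewrite ?ltn_divLR ?(mulnC _ 2%N)// => j jd.
  by rewrite -!divnMA -expnS; exact: digits.
rewrite -(odd_double_half m) -(odd_double_half n) digit0.
by rewrite -!divn2 half.
Qed.

Section BinaryEnumeration.
Context {d : nat}.

Lemma binary_corner_inj (m n : nat) : (m < 2 ^ d)%N -> (n < 2 ^ d)%N ->
  binary_corner m = binary_corner n :> corner_idx d -> m = n.
Proof.
move=> m_lt n_lt /ffunP mn; apply: (@binary_digits_inj d) => // j jd.
by have := mn (Ordinal jd); rewrite !ffunE.
Qed.

Lemma binary_corner_surj (a : corner_idx d) :
  exists2 n, (n < 2 ^ d)%N & binary_corner n = a.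
Proof.
have inj : injective (fun n : 'I_(2 ^ d) => binary_corner n : corner_idx d).
  move=> m n mn; apply: val_inj.
  exact: (binary_corner_inj _ _ (ltn_ord m) (ltn_ord n) mn).
have := inj_card_onto inj.
rewrite card_ffun card_bool !card_ord leqnn => /(_ isT a)/codomP[n ->].
by exists n.
Qed.

Lemma adj_vertex (a b : corner_idx d) (i : 'I_d) : a i != b i ->
  (forall j, j != i -> a j = b j) -> adj (vertex a) (vertex b).
Proof.
move=> abi abj; rewrite /adj (bigD1 i)//= big1 => [|j ji].
  by rewrite !mxE addr0; move: abi; case: (a i); case: (b i).
by rewrite !mxE abj// subrr.
Qed.

(** Removing the leading binary digit of n + 1 gives a smaller number, whose
    vertex differs in one coordinate. *)
Lemma binary_corner_adj (n : nat) : (n.+1 < 2 ^ d)%N ->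
  exists2 m, (m <= n)%N &
    adj (vertex (binary_corner m : corner_idx d)) (vertex (binary_corner n.+1)).
Proof.
move=> n_lt; pose k := trunc_log 2 n.+1.
have /andP[kn nk] : (2 ^ k <= n.+1 < 2 ^ k.+1)%N by exact: trunc_log_bounds.
pose r := (n.+1 - 2 ^ k)%N.
have nE : n.+1 = (2 ^ k + r)%N by rewrite subnKC.
have r_lt : (r < 2 ^ k)%N.
  by move: nk; rewrite nE expnS mul2n -addnn ltn_add2l.
have kd : (k < d)%N.
  by rewrite -(@ltn_exp2l 2)//; exact: leq_ltn_trans kn n_lt.
(* The number without its leading digit, at position k. *)
exists r.
  by rewrite -ltnS nE -[X in (X < _)%N]add0n ltn_add2r expn_gt0.
apply: (@adj_vertex _ _ (Ordinal kd)) => [|j].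
  by rewrite !ffunE /= nE -[X in (X + r)%N]mul1n divnMDl ?expn_gt0// divn_small.
rewrite -val_eqE /= => jk; rewrite !ffunE nE.
case: (ltngtP j k) jk => // [jk|kj] _.
  have -> : (2 ^ k = 2 ^ (k - j) * 2 ^ j)%N by rewrite -expnD subnK// ltnW.
  rewrite divnMDl ?expn_gt0// oddD oddX /=.
  by rewrite subn_eq0 leqNgt jk.
rewrite !divn_small//.
  by rewrite -nE; apply: leq_trans nk _; rewrite leq_exp2l.
by apply: leq_trans r_lt _; rewrite leq_exp2l// ltnW.
Qed.

End BinaryEnumeration.

(** * Condition K1 *)

Section ConditionK.
Context {R : realType} {d : nat}.
Variable P : probability (env R d) R.

Lemma revealed_cst (I : Type) (D : set I) (g : I -> env R d -> site d)
  (A : Prop) : revealed D g [set w | A].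
Proof.
have [a|na] := pselect A.
  rewrite (_ : [set w | A] = setT); last by apply/seteqP; split.
  by rewrite -setC0; apply: sigma_algebraC; exact: sigma_algebra0.
rewrite (_ : [set w | A] = set0); first exact: sigma_algebra0.
by apply/seteqP; split.
Qed.

Lemma binary_markovian_cube :
  markovian_cube P (fun n _ => vertex (binary_corner n)) (fun=> unit_cube 0).
Proof.
split.
- by move=> w; exact: cubes_at0_unit_cube.
- move=> w; apply/seteqP; split => y /=.
    move=> /unit_cube0P[a ->]; have [n n_lt <-] := binary_corner_surj a.
    by exists n.
  by move=> [n n_lt <-]; apply/unit_cube0P; exists (binary_corner n).
- move=> x; have [xE|xE] := pselect (vertex (binary_corner 0) = x).
    by rewrite (_ : [set _ | _] = setT)//; apply/seteqP; split.
  by rewrite (_ : [set _ | _] = set0)//; apply/seteqP; split.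
- by apply: aeW => w; rewrite binary_corner0 vertex_origin.
- by move=> i i_lt x; exact: revealed_cst.
- move=> i i_lt w; split.
    move=> [j /= ji /vertex_inj eqc].
    have ij := binary_corner_inj _ _ (ltn_trans ji i_lt) i_lt eqc.
    by rewrite ij ltnn in ji.
  have [m mi madj] := binary_corner_adj _ i_lt.
  exists (vertex (binary_corner m)); first by exists m.
  rewrite /adj -[RHS]madj.
  by apply: eq_bigr => j _; rewrite distrC.
- move=> i i_lt; apply: aeW => w; exists (unit_cube 0).
    exact: cubes_at0_unit_cube.
  by move=> y [n _ <-]; apply/unit_cube0P; exists (binary_corner n).
Qed.

(** Leaving the hypercube at the first step, through an edge at 0, is one way to
    realise the event. *)
Lemma Qtilde_ge (Pq : env R d -> site d -> probability (walk d) R) (w : env R d)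
    (i : 'I_d) : is_quenched_law w 0 (Pq w 0) ->
  ((prob_at w 0%R (outward origin i))%:E <= Qtilde Pq (unit_cube 0%R) 0%R 0%R w)%E.
Proof.
move=> [start step]; set e := outward origin i.
have := outward_bdry origin i; rewrite vertex_origin add0r -/e => e_bdry.
have -> : ((prob_at w 0%R e)%:E =
    Pq w 0%R (follows 0 (fun=> 0%R) `&` [set X : walk d | X 1%N = (0 + evec e)%R]))%E.
  rewrite (step 0%N (fun=> 0) e) -[LHS]mul1e -start; congr (Pq w 0%R _ * _)%E.
  apply/seteqP; split => X /= X0; last exact: X0.
  by move=> k; rewrite leqn0 => /eqP ->.
apply: le_measure; rewrite ?inE.
- by apply: measurableI; [exact: measurable_follows|
    exact: (measurable_walk_in 1 [set 0 + evec e])].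
- exact: measurable_at_hit_before_return.
move=> X [X0 /=]; rewrite add0r => X1.
have hit1 : hit_time R (bdry (unit_cube 0)) X = 1%:R%:E.
  apply/hit_timeP; split; first by rewrite X1; exact: e_bdry.1.
  move=> k; rewrite ltnS leqn0 => /eqP ->; rewrite X0// => -[nC _]; apply: nC.
  by have [] := cubes_at0_unit_cube (d := d).
split; last by exists 1%N; rewrite ?X1.
rewrite hit1; apply/return_time_gt => k; rewrite andbC -eqn_leq => /eqP ->.
rewrite X1 => e0; have [[]] := e_bdry; rewrite e0; case.
by have [] := cubes_at0_unit_cube (d := d).
Qed.

(** The marks are 2 at the vertex 0 and 0 elsewhere; with gamma = 2 everywhere
    the sum in the third part is 2, which leaves the margin 1. *)
Lemma two_directions_cond_K1 (Pq : env R d -> site d -> probability (walk d) R)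
    (k : R) : (2 <= d)%N -> (forall w x, is_quenched_law w x (Pq w x)) -> 0 < k ->
  {ae P, forall w, forall x e e', e != e' ->
     k <= prob_at w x e \/ k <= prob_at w x e'} ->
  cond_K1 P Pq.
Proof.
move=> d_ge2 Pq_law k0 two.
pose i1 : 'I_d := Ordinal (ltnW d_ge2); pose i2 : 'I_d := Ordinal d_ge2.
have good : {ae P, forall w, forall a : corner_idx d, exists i,
    k <= prob_at w (vertex a) (outward a i)}.
  apply: filterS two => w two a.
  have : outward a i1 != outward a i2 by rewrite (inj_eq (@outward_inj _ a)).
  by move=> /(two (vertex a))[]; [exists i1|exists i2].
have int_cst : (\int[P]_w (cst (k `^ (- 2))%:E) w < +oo)%E.
  rewrite integral_cst// lte_mul_pinfty ?lee_fin ?powR_ge0//.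
  exact: le_lt_trans (probability_le1 P measurableT) (ltry 1).
exists (fun=> 2), (fun=> unit_cube 0),
  (fun a _ => if a == origin then 2 else 0); split => //.
- move=> a; apply: le_lt_trans int_cst.
  apply: ae_le_integral_nonmeasurable => //.
  + by move=> w; exact: invpow_ge0.
  + by move=> w; rewrite lee_fin powR_ge0.
  + apply: filterS good => w /(_ a)[i ki].
    apply: invpow_le => //; rewrite lee_fin; apply: le_trans ki _.
    rewrite /Qmax; apply: (le_bigmax_cond _ (prob_at w (vertex a))).
    by apply/asboolP; exact: outward_bdry.
- split.
  + by exists (fun n _ => vertex (binary_corner n)); exact: binary_markovian_cube.
  + by move=> a w; case: ifP.
  + by move=> a B mB; exact: revealed_cst.
- apply: le_lt_trans int_cst.
  apply: ae_le_integral_nonmeasurable => //.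
  + by move=> w; apply: prode_ge0 => a _; exact: invpow_ge0.
  + by move=> w; rewrite lee_fin powR_ge0.
  + apply: filterS good => w /(_ origin)[i ki].
    rewrite (bigD1 origin)//= eqxx big1 => [|a /negPf ->]; last exact: invpow0.
    rewrite mule1 base_point_cube0 vertex_origin addr0.
    apply: invpow_le => //; apply: le_trans (Qtilde_ge _ _ i (Pq_law w 0)).
    by rewrite lee_fin -[X in prob_at _ X]vertex_origin.
- exists 1 => //; apply: aeW => w; rewrite (bigD1 origin)//= eqxx minxx.
  rewrite lerDl sumr_ge0// => a /negPf ->.
  by rewrite le_min lexx ler0n.
Qed.

End ConditionK.

(** * The explicit environment *)

(* The guard on (T): for eps = 1/2 the law P is invariant under e |-> - e and
   condition (T) fails. *)
Theorem proposition4p3 (R : realType) (d : nat) (d_ge2 : (2 <= d)%N)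
    (disp : measure_display) (S : measurableType disp) (mu : probability S R)
    (T : {RV mu >-> R}) (i0 : S -> dir d) (eps : R)
    (T_ge : {ae mu, forall s, (2 * d + 1)%:R <= T s})
    (T_inf : ('E_mu[(fun s => (T s `^ (1 / (4 * d)%:R))%R)] = +oo)%E)
    (T_fin : ('E_mu[(fun s => (T s `^ (1 / (8 * d)%:R))%R)] < +oo)%E)
    (i0_meas : forall i, measurable (i0 @^-1` [set i]))
    (i0_unif : forall i, mu (i0 @^-1` [set i]) = (1 / (2 * d)%:R)%:E)
    (i0_indep : forall (B : set R) i, measurable B ->
       mu (T @^-1` B `&` i0 @^-1` [set i]) =
       (mu (T @^-1` B) * mu (i0 @^-1` [set i]))%E)
    (eps_gt : 1 / (2 * d + 1)%:R < eps)
    (eps_lt : eps < (2 * d)%:R / (2 * d + 1)%:R)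
    (P : probability (env R d) R) (P_expl : is_P_expl mu T i0 eps P)
    (Pq : env R d -> site d -> probability (walk d) R)
    (Pq_law : forall w x, is_quenched_law w x (Pq w x)) :
  [/\ cond_K1 P Pq, ~ cond_E'1 P, eps <> 1 / 2 -> cond_T P Pq & cond_E0 P].
Proof.
have d_gt0 : (0 < d)%N by exact: ltnW.
split.
- apply: (@two_directions_cond_K1 _ _ _ _ (kappa d eps)) => //.
    exact: kappa_gt0.
  exact: (@ae_two_directions _ _ _ _ mu T i0).
- exact: (@expl_not_cond_E'1 _ _ _ _ mu T i0 eps).
- apply: constant_drift_cond_T => //.
  exact: (@ae_drift _ _ _ _ mu T i0).
- exact: (@expl_cond_E0 _ _ _ _ mu T i0 eps).
Qed.
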